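(* Let $\lambda,\kappa\ge0$ and $\gamma>0$, and let $\{(X_t,v_t):t\ge0\}$ be the run-and-tumble process on $\mathbb{Z}\times\{-1,1\}$ with parameters $(\lambda,\kappa,\gamma)$ (generator $L$ given in the context), started from $X_0=0$ and an arbitrary initial velocity distribution on $\{-1,1\}$. Put $$\sigma^2=2\kappa+\lambda+\frac{\lambda^2}{\gamma}$$ and $S(q,z)=\int_0^\infty\mathbb{E}\left(e^{iqX_t}\right)e^{-zt}\,dt$ for $q\in\mathbb{R}$, $z>0$. Then $$\lim_{\epsilon\to0}\epsilon^2S(\epsilon q,\epsilon^2z)=\frac{1}{z+\frac{q^2}{2}\sigma^2}\qquad\text{for all } q\in\mathbb{R},\ z>0,$$ and for every $t>0$, $\epsilon X_{\epsilon^{-2}t}$ converges in distribution, as $\epsilon\to0$ (with $\epsilon>0$), to a normal random variable with mean $0$ and variance $\sigma^2t$.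
   Context: The run-and-tumble process with parameters $(\lambda,\kappa,\gamma)$ is the continuous-time Markov jump process on $\mathbb{Z}\times\{-1,1\}$ ($X_t$ is the position, $v_t$ the velocity) with generator $$Lf(x,v)=\lambda\big(f(x+v,v)-f(x,v)\big)+\kappa\big(f(x+1,v)+f(x-1,v)-2f(x,v)\big)+\gamma\big(f(x,-v)-f(x,v)\big).$$ A normal distribution with variance $0$ is understood as the Dirac mass at its mean. *)

(* Defs.v *)
From HB Require Import structures.
From mathcomp Require Import all_boot all_order all_algebra.
From mathcomp Require Import all_classical all_reals all_analysis.
From mathcomp Require Import complex.

Set Implicit Arguments.
Unset Strict Implicit.
Unset Printing Implicit Defensive.
Import Order.TTheory GRing.Theory Num.Theory.
Import numFieldNormedType.Exports.
Local Open Scope classical_set_scope.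
Local Open Scope ring_scope.

(* The state space Z x {-1,1}: the Boolean [false] stands for the velocity 1
   and [true] for the velocity -1, so that [~~ v] is the opposite velocity. *)
Definition state : Type := (int * bool)%type.

HB.instance Definition _ := Choice.on state.
HB.instance Definition _ := isPointed.Build state ((0, false) : int * bool).
HB.instance Definition _ := @isMeasurable.Build default_measure_display
  state discrete_measurable discrete_measurable0
  discrete_measurableC discrete_measurableU.

Definition position (x : state) : int := x.1.
Definition velocity (v : bool) : int := (-1) ^+ v.

Definition rt_generator (R : realType) (lambda kappa gamma : R)
    (f : state -> R) (s : state) : R :=
  let: (x, v) := s in
  lambda * (f (x + velocity v, v) - f (x, v))
  + kappa * (f (x + 1, v) + f (x - 1, v) - 2 * f (x, v))
  + gamma * (f (x, ~~ v) - f (x, v)).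

Section MarkovJumpProcess.
Context (R : realType).

Definition bounded_function (E : Type) (f : E -> R) : Prop :=
  exists M : R, forall x, `|f x| <= M.

(* Only the times [t >= 0] are meaningful. *)
Definition transition_semigroup (p : R -> R.-pker state ~> state) : Prop :=
  (forall x (B : set state), p 0 x B = dirac x B)
  /\ (forall s t : R, 0 <= s -> 0 <= t -> forall x (B : set state),
        p (s + t) x B = (\int[p s x]_y p t y B)%E).

(* [L] is the generator, for the supremum norm, of the semigroup
   [f |-> (x |-> \int f d(p t x))] on bounded functions; all of them belong to
   the domain. *)
Definition has_generator (p : R -> R.-pker state ~> state)
    (L : (state -> R) -> state -> R) : Prop :=
  forall f : state -> R, bounded_function f ->
  forall e : R, 0 < e ->
  \forall h \near 0^'+, forall x : state,
    `| h^-1 * ((\int[p h x]_y f y)%R - f x) - L f x | <= e.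

Context d (T : measurableType d) (P : probability T R).

Definition natural_filtration (Y : R -> T -> state) (s : R) : set (set T) :=
  <<s [set A | exists (u : R) (B : set state), 0 <= u <= s /\ A = Y u @^-1` B] >>.

(* [P (Y (s + t) \in B | F_s) = p t (Y s) B] almost surely. *)
Definition markov_property (Y : R -> {RV P >-> state})
    (p : R -> R.-pker state ~> state) : Prop :=
  forall s t : R, 0 <= s -> 0 <= t ->
  forall (A : set T) (B : set state),
    natural_filtration (fun u => Y u : T -> state) s A ->
    P (A `&` Y (s + t) @^-1` B) = (\int[P]_(w in A) p t (Y s w) B)%E.

(* Right-continuity with left limits, for the discrete topology. *)
Definition jump_path (y : R -> state) : Prop :=
  (forall t : R, 0 <= t -> \forall s \near t^'+, y s = y t)
  /\ (forall t : R, 0 < t -> exists x, \forall s \near t^'-, y s = x).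

Definition markov_jump_process (L : (state -> R) -> state -> R)
    (Y : R -> {RV P >-> state}) : Prop :=
  {ae P, forall w, jump_path (fun t => Y t w)}
  /\ exists p : R -> R.-pker state ~> state,
       [/\ transition_semigroup p, has_generator p L & markov_property Y p].

End MarkovJumpProcess.

Definition run_and_tumble (R : realType) (lambda kappa gamma : R)
    d (T : measurableType d) (P : probability T R)
    (Y : R -> {RV P >-> state}) : Prop :=
  markov_jump_process (rt_generator lambda kappa gamma) Y.

Definition cintegral (R : realType) d (T : measurableType d)
    (mu : {measure set T -> \bar R}) (D : set T) (f : T -> R[i]) : R[i] :=
  Complex (\int[mu]_(x in D) complex.Re (f x))%R
          (\int[mu]_(x in D) complex.Im (f x))%R.

Definition expi (R : realType) (a : R) : R[i] := Complex (cos a) (sin a).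

Definition char_position (R : realType) d (T : measurableType d)
    (P : probability T R) (Y : R -> {RV P >-> state}) (q t : R) : R[i] :=
  cintegral P setT (fun w => expi (q * (position (Y t w))%:~R)).

Definition laplace_char (R : realType) d (T : measurableType d)
    (P : probability T R) (Y : R -> {RV P >-> state}) (q z : R) : R[i] :=
  cintegral (@lebesgue_measure R) `[0, +oo[
    (fun t => char_position Y q t * (expR (- (z * t)))%:C%C).

Definition diffusivity (R : realType) (lambda kappa gamma : R) : R :=
  2 * kappa + lambda + lambda ^+ 2 / gamma.

(* The second parameter is the variance, whereas that of [normal_prob] is the
   standard deviation; [normal_prob m 0] is not the Dirac mass at [m]. *)
Definition normal_law (R : realType) (m v : R) :
    probability (measurableTypeR R) R :=
  if v == 0 then (@dirac _ (measurableTypeR R) m R : probability (measurableTypeR R) R)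
  else (normal_prob m (Num.sqrt v) : probability (measurableTypeR R) R).

Definition cvg_in_distribution (R : realType) d (T : measurableType d)
    (P : probability T R) (I : Type) (F : set_system I) (W : I -> T -> R)
    (nu : probability (measurableTypeR R) R) : Prop :=
  forall g : R -> R, continuous g -> bounded_function g ->
    ('E_P[g \o W i])%E @[i --> F] --> (\int[nu]_x (g x)%:E)%E.

(* Main.v *)
Require Import Defs.
From HB Require Import structures.
From mathcomp Require Import all_boot all_order all_algebra.
From mathcomp Require Import all_classical all_reals all_analysis.
From mathcomp Require Import measurable_realfun complex.
From mathcomp Require Import ring lra.

Set Implicit Arguments.
Unset Strict Implicit.
Unset Printing Implicit Defensive.
Import Order.TTheory GRing.Theory Num.Theory.
Import numFieldNormedType.Exports.
Local Open Scope classical_set_scope.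
Local Open Scope ring_scope.

(** Fourier modes that are tilted by the velocity are eigenfunctions of the
    generator. Put b = lambda sin q and suppose |b| <= gamma. The functions
    exp(iqx) and v exp(iqx) span a space that the generator preserves, and this
    space contains exp(iqx) (1 + i d v), where d is the small root of b d^2 - 2
    gamma d + b = 0. It is an eigenfunction ([rt_generator_eigenfun]) with the
    real eigenvalue m(q) = - (lambda + 2 kappa) (1 - cos q) - b d <= 0.

    The expectation of an eigenfunction f is E f(Y_t) = exp(m t) E f(Y_0)
    ([expectation_eigenfun]): the generator is a uniform limit, so the Markov
    property gives this linear differential equation up to errors that are
    uniform in time. Since d = O(q) and X_0 = 0, dropping the velocity term
    shows that E exp(iqX_t) is exp(m(q) t) up to O(q), uniformly in t
    ([char_estimate]). This error disappears in the diffusive scaling, and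
    m(eps q) / eps^2 tends to - sigma^2 q^2 / 2 ([cvg_rt_eigenvalue_scaled]):
    the jumps contribute (lambda + 2 kappa) q^2 / 2, and the term b d, which is
    of order b^2 / (2 gamma), contributes lambda^2 q^2 / (2 gamma).

    Integrating the estimate against exp(-z t) gives the limit of the Laplace
    transform ([laplace_estimate], [cvg_laplace_scaled]). At a fixed time it
    gives the convergence of characteristic functions ([cvg_char_scaled]), and
    hence convergence in distribution by Levy's continuity theorem
    ([levy_continuity]). The latter is proved by Gaussian smoothing: the
    Gaussian is its own Fourier transform ([normal_fourier]), so the density of
    a smoothed probability measure is an integral of its characteristic
    function ([smoothed_densityE]), while smoothing changes the integral of a
    uniformly continuous function by an amount that is bounded independently of
    the measure ([smoothing_error]). *)

(** * Integrals of real-valued functions *)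

Section integrals.
Context d (T : measurableType d) (R : realType).
Implicit Types mu : {measure set T -> \bar R}.

Lemma integrable_bounded (P : probability T R) (f : T -> R) (M : R) :
  measurable_fun setT f -> (forall x, `|f x| <= M) ->
  P.-integrable setT (EFin \o f).
Proof.
move=> mf fM; apply: measurable_bounded_integrable => //.
  by rewrite -ge0_fin_numE// fin_num_measure.
exists M; split; first by rewrite num_real.
by move=> x Mx y _ /=; rewrite (le_trans (fM y))// ltW.
Qed.

Lemma integrable_scale mu D (k : R) (f : T -> R) :
  measurable D -> mu.-integrable D (EFin \o f) ->
  mu.-integrable D (EFin \o (fun x => k * f x)).
Proof.
move=> mD fi.
rewrite (_ : EFin \o _ = (fun x => k%:E * (f x)%:E)%E); first exact: integrableZl.
by apply/funext => x /=; rewrite EFinM.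
Qed.

Lemma integrable_sub mu D (f g : T -> R) :
  measurable D -> mu.-integrable D (EFin \o f) -> mu.-integrable D (EFin \o g) ->
  mu.-integrable D (EFin \o (fun x => f x - g x)).
Proof. by move=> mD fi gi; exact: (integrableB mD fi gi). Qed.

Lemma Rintegral_prob_cst (P : probability T R) (c : R) : \int[P]_x c = c.
Proof.
rewrite Rintegral_cst// (_ : fine _ = 1) ?mulr1//.
by have /(congr1 fine) := probability_setT P.
Qed.

Lemma le_norm_Rintegral_prob (P : probability T R) (f : T -> R) (M : R) :
  measurable_fun setT f -> (forall x, `|f x| <= M) ->
  `|\int[P]_x f x| <= M.
Proof.
move=> mf fM; have fi := integrable_bounded P mf fM.
apply: (le_trans (le_normr_Rintegral measurableT fi)).
rewrite -[leRHS](Rintegral_prob_cst P); apply: le_Rintegral => //.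
  exact: (integrable_norm fi).
by apply: (@integrable_bounded P _ `|M|).
Qed.

Lemma dominated_cvg_Rintegral mu (f_ : (T -> R)^nat) (f g : T -> R) :
  (forall n, measurable_fun setT (f_ n)) -> measurable_fun setT f ->
  (forall x, f_ n x @[n --> \oo] --> f x) ->
  mu.-integrable setT (EFin \o g) ->
  (forall n x, `|f_ n x| <= g x) ->
  \int[mu]_x f_ n x @[n --> \oo] --> \int[mu]_x f x.
Proof.
move=> mf_ mf ff gi fg.
have [|||||fi _ h] := @dominated_convergence _ _ _ mu setT measurableT
  (fun n => EFin \o f_ n) (EFin \o f) (EFin \o g).
- by move=> n; exact/measurable_EFinP.
- exact/measurable_EFinP.
- by apply: aeW => x _; apply: cvg_EFin; [exact: nearW|exact: ff].
- exact: gi.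
- by apply: aeW => x n _; rewrite lee_fin.
apply: fine_cvg; rewrite fineK//.
exact: integrable_fin_num.
Qed.

End integrals.

Section Rfubini.
Context d1 d2 (T1 : measurableType d1) (T2 : measurableType d2) (R : realType).
Variable m1 : {sigma_finite_measure set T1 -> \bar R}.
Variable m2 : {sigma_finite_measure set T2 -> \bar R}.

Lemma Rintegral_fubini (f : T1 * T2 -> R) :
  (m1 \x m2)%E.-integrable setT (EFin \o f) ->
  (forall x, m2.-integrable setT (EFin \o (fun y => f (x, y)))) ->
  (forall y, m1.-integrable setT (EFin \o (fun x => f (x, y)))) ->
  \int[m1]_x \int[m2]_y f (x, y) = \int[m2]_y \int[m1]_x f (x, y).
Proof.
move=> fi fi1 fi2; congr fine.
transitivity (\int[m1]_x \int[m2]_y (EFin \o f) (x, y))%E.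
  apply: eq_integral => x _; rewrite fineK//.
  exact: (integrable_fin_num measurableT (fi1 x)).
rewrite Fubini//; apply: eq_integral => y _; rewrite fineK//.
exact: (integrable_fin_num measurableT (fi2 y)).
Qed.

Lemma measurable_Rintegral_fubini (f : T1 * T2 -> R) :
  (m1 \x m2)%E.-integrable setT (EFin \o f) ->
  measurable_fun setT (fun x => \int[m2]_y f (x, y)).
Proof.
move=> fi; apply: measurableT_comp => //.
exact: (measurable_fubini_F fi).
Qed.

Lemma measurable_Rintegral_fubini2 (f : T1 * T2 -> R) :
  (m1 \x m2)%E.-integrable setT (EFin \o f) ->
  measurable_fun setT (fun y => \int[m1]_x f (x, y)).
Proof.
move=> fi; apply: measurableT_comp => //.
exact: (measurable_fubini_G fi).
Qed.

End Rfubini.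

Section normal.
Context {R : realType}.
Notation mu := (@lebesgue_measure R).
Implicit Types (m s : R) (f : R -> R).

(** The Radon-Nikodym derivative is unique up to a null set, hence equal to the
    density almost everywhere. *)
Lemma Rintegral_normal_prob m s f :
  (normal_prob m s).-integrable setT (EFin \o f) ->
  \int[normal_prob m s]_x f x = \int[mu]_x (f x * normal_pdf m s x).
Proof.
move=> fi; congr fine.
have dom := normal_prob_dominates m s.
rewrite -(Radon_Nikodym_change_of_variables dom)//=.
apply: ae_eq_integral => //=.
- by apply: emeasurable_funM => //=; exact: (measurable_int _ fi).
- apply/measurable_EFinP/measurable_funM; last exact: measurable_normal_pdf.
  by have /measurable_EFinP := measurable_int _ fi.
- under [X in ae_eq _ _ _ X]funext do rewrite EFinM.
  apply: ae_eqe_mul2l; apply: integral_ae_eq => //=.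
  + exact: Radon_Nikodym_integrable.
  + by apply/measurable_EFinP; exact: measurable_normal_pdf.
  + by move=> E _ mE; rewrite -Radon_Nikodym_integral.
Qed.

Lemma integrable_mul_normal_pdf m s f (M : R) :
  measurable_fun setT f -> (forall y, `|f y| <= M) ->
  mu.-integrable setT (EFin \o (fun y => f y * normal_pdf m s y)).
Proof.
move=> mf fM; apply: (@le_integrable _ _ R mu setT measurableT _
    (EFin \o (fun y => M * normal_pdf m s y))) => //.
- by apply/measurable_EFinP/measurable_funM => //; exact: measurable_normal_pdf.
- move=> y _ /=; rewrite lee_fin !normrM ler_wpM2r//.
  by rewrite (le_trans (fM y))// ler_norm.
- by apply: integrable_scale => //; exact: integrable_normal_pdf.
Qed.

End normal.

(** * The Fourier transform of a centred Gaussian *)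

Section gaussian_fourier.
Context {R : realType}.
Notation mu := (@lebesgue_measure R).
Implicit Types (h H : R -> R) (s q x : R).

(** The fundamental theorem of calculus on [-n, n], and dominated convergence
    as n grows. *)
Lemma Rintegral_derive_eq0 H h :
  (forall x, is_derive x 1 H (h x)) -> continuous h ->
  mu.-integrable setT (EFin \o h) ->
  H n%:R - H (- n%:R) @[n --> \oo] --> (0 : R) ->
  \int[mu]_x h x = 0.
Proof.
move=> dH ch hi H0.
have mh : measurable_fun setT h by exact: continuous_measurable_fun.
have cvgh : \int[mu]_x (h x * \1_(`[- n%:R, n%:R]%classic) x)
    @[n --> \oo] --> \int[mu]_x h x.
  apply: (@dominated_cvg_Rintegral _ _ R mu
    (fun n x => h x * \1_(`[- n%:R, n%:R]%classic) x) h (fun x => `|h x|)).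
  - by move=> n; apply: measurable_funM => //; exact: measurable_indic.
  - exact: mh.
  - move=> x; apply: cvg_near_cst; near=> n.
    rewrite indicE mem_set ?mulr1//= in_itv/= -ler_norml.
    by near: n; exact: nbhs_infty_ger.
  - exact: (integrable_norm hi).
  - move=> n x; rewrite normrM /= ler_piMr//.
    by rewrite indicE; case: (_ \in _); rewrite ?normr1 ?normr0.
apply/esym/(cvg_unique _ H0) => //; apply: cvg_trans cvgh.
apply: near_eq_cvg; near=> n.
have n0 : (- n%:R < n%:R :> R).
  by rewrite gtrN// ltr0n; near: n; exact: nbhs_infty_gt.
transitivity (\int[mu]_(x in `[- n%:R, n%:R]) h x).
  rewrite [RHS]Rintegral_mkcond; apply: eq_Rintegral => x _.
  by rewrite patchE indicE; case: ifPn => _; rewrite ?mulr1 ?mulr0.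
have dbl y : derivable H y 1 by have [] := dH y.
have cH : continuous H.
  by move=> y; apply/differentiable_continuous/derivable1_diffP.
rewrite /Rintegral (@continuous_FTC2 _ h H) //=.
- exact: continuous_subspaceT.
- split => [y _|//|//]; first exact: dbl.
  + by apply: cvg_at_right_filter; exact: cH.
  + by apply: cvg_at_left_filter; exact: cH.
- by move=> y _; rewrite derive1E; have [_ ->] := dH y.
Unshelve. all: by end_near. Qed.

Lemma is_derive_affine q c x : is_derive x 1 (fun y : R => q * y + c) q.
Proof.
rewrite [X in is_derive _ _ _ X](_ : _ = q *: 1 + 0).
  exact: (is_deriveD (is_deriveZ q (is_derive_id x (1 : R))) (is_derive_cst c x 1)).
by rewrite scaler1 addr0.
Qed.

Lemma is_derive_sin_affine q c x :
  is_derive x 1 (fun y : R => sin (q * y + c)) (q * cos (q * x + c)).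
Proof.
by rewrite mulrC; apply: (@is_derive1_comp _ sin); exact: is_derive_affine.
Qed.

Lemma is_derive_cos_affine q c x :
  is_derive x 1 (fun y : R => cos (q * y + c)) (- q * sin (q * x + c)).
Proof.
rewrite mulNr -mulrN mulrC; apply: (@is_derive1_comp _ cos).
exact: is_derive_affine.
Qed.

Lemma continuous_sin_affine q c : continuous (fun x : R => sin (q * x + c)).
Proof.
move=> x; apply/differentiable_continuous/derivable1_diffP.
by have [] := is_derive_sin_affine q c x.
Qed.

Lemma continuous_cos_affine q c : continuous (fun x : R => cos (q * x + c)).
Proof.
move=> x; apply/differentiable_continuous/derivable1_diffP.
by have [] := is_derive_cos_affine q c x.
Qed.

Lemma measurable_sin_affine q c :
  measurable_fun setT (fun x : R => sin (q * x + c)).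
Proof. by apply: continuous_measurable_fun; exact: continuous_sin_affine. Qed.

Lemma measurable_cos_affine q c :
  measurable_fun setT (fun x : R => cos (q * x + c)).
Proof. by apply: continuous_measurable_fun; exact: continuous_cos_affine. Qed.

Lemma measurable_scale_sin q : measurable_fun setT (fun x : R => sin (q * x)).
Proof. by under eq_fun do rewrite -[_ * _]addr0; exact: measurable_sin_affine. Qed.

Lemma measurable_scale_cos q : measurable_fun setT (fun x : R => cos (q * x)).
Proof. by under eq_fun do rewrite -[_ * _]addr0; exact: measurable_cos_affine. Qed.

Section fixed_variance.
Variable s : R.
Hypothesis s0 : 0 < s.
Local Notation p := (normal_pdf 0 s).

Lemma normal_pdf0E x : p x = normal_peak s * expR (- (s ^- 2 / 2) * x ^+ 2).
Proof.
rewrite normal_pdfE ?gt_eqF// /normal_fun subr0; congr (_ * expR _).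
rewrite -mulr_natr; field.
by rewrite gt_eqF.
Qed.

Lemma is_derive_normal_pdf x : is_derive x 1 p (- (s ^- 2) * x * p x).
Proof.
have -> : p = (fun y => normal_peak s * expR (- (s ^- 2 / 2) * y ^+ 2)).
  by apply/funext => y; rewrite normal_pdf0E.
have d1 : is_derive x 1 (fun y : R => - (s ^- 2 / 2) * y ^+ 2) (- s ^- 2 * x).
  rewrite (_ : - s ^- 2 * x = - (s ^- 2 / 2) *: ((2 * x ^+ 1) *: 1)).
    exact: (is_deriveZ _ (is_deriveX 2 (is_derive_id x (1 : R)))).
  by rewrite expr1 /GRing.scale/=; field; rewrite gt_eqF.
have d2 : is_derive x 1 (fun y : R => expR (- (s ^- 2 / 2) * y ^+ 2))
    (expR (- (s ^- 2 / 2) * x ^+ 2) * (- s ^- 2 * x)).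
  exact: (@is_derive1_comp _ expR _ _ _ _ (is_derive_expR _) d1).
rewrite [X in is_derive _ _ _ X](_ : _ = normal_peak s *:
  (expR (- (s ^- 2 / 2) * x ^+ 2) * (- s ^- 2 * x))).
  exact: (is_deriveZ (normal_peak s) d2).
by rewrite /GRing.scale/=; ring.
Qed.

(** A Gaussian of twice the variance dominates: with u = x^2 / (4 s^2) one has
    |x| <= 2 s (1 + u) <= 2 s exp(u), and the density has the factor
    exp(-u)^2. *)
Lemma integrable_abs_normal_pdf :
  mu.-integrable setT (EFin \o (fun x => `|x| * p x)).
Proof.
set t := Num.sqrt 2 * s.
have t0 : 0 < t by rewrite mulr_gt0// sqrtr_gt0.
set C := 2 * s * normal_peak s / normal_peak t.
apply: (@le_integrable _ _ R mu setT measurableT _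
    (EFin \o (fun x => C * normal_pdf 0 t x))) => //.
- apply/measurable_EFinP/measurable_funM; last exact: measurable_normal_pdf.
  by apply: continuous_measurable_fun; exact: norm_continuous.
- move=> x _ /=; rewrite lee_fin normrM normr_id ger0_norm ?normal_pdf_ge0//.
  rewrite [leRHS]ger0_norm; last first.
    by rewrite mulr_ge0 ?normal_pdf_ge0// divr_ge0 ?normal_peak_ge0//
      mulr_ge0 ?normal_peak_ge0// mulr_ge0// ltW.
  rewrite normal_pdf0E normal_pdfE ?gt_eqF// /normal_fun subr0.
  have -> : - x ^+ 2 / (t ^+ 2 *+ 2) = - (s ^- 2 / 4) * x ^+ 2.
    rewrite /t exprMn sqr_sqrtr// -mulr_natr; field.
    by rewrite gt_eqF.
  rewrite /C.
  have -> : - (s ^- 2 / 2) * x ^+ 2 =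
    - (s ^- 2 / 4) * x ^+ 2 + - (s ^- 2 / 4) * x ^+ 2 by field; rewrite gt_eqF.
  rewrite expRD; set e := expR _.
  have -> : 2 * s * normal_peak s / normal_peak t * (normal_peak t * e) =
    normal_peak s * e * (2 * s).
    by field; rewrite gt_eqF// normal_peak_gt0// gt_eqF.
  rewrite [leLHS](_ : _ = normal_peak s * e * (`|x| * e)); last by ring.
  rewrite ler_wpM2l ?mulr_ge0 ?normal_peak_ge0 ?expR_ge0//.
  rewrite /e mulNr expRN ler_pdivrMr ?expR_gt0//.
  apply: (@le_trans _ _ (2 * s * (1 + s ^- 2 / 4 * x ^+ 2))); last first.
    by rewrite ler_pM2l ?mulr_gt0// expR_ge1Dx.
  rewrite -(real_normK (num_real x)).
  have : 0 <= (2 * s) * (1 - `|x| / (2 * s)) ^+ 2 / 1.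
    by rewrite divr1 mulr_ge0 ?sqr_ge0// mulr_ge0// ltW.
  have -> : (2 * s) * (1 - `|x| / (2 * s)) ^+ 2 / 1 =
    2 * s * (1 + s ^- 2 / 4 * `|x| ^+ 2) - 2 * `|x|.
    by field; rewrite gt_eqF.
  by rewrite subr_ge0; apply: le_trans; rewrite ler_peMl// ler1n.
- by apply: integrable_scale => //; exact: integrable_normal_pdf.
Qed.

Lemma cvg_normal_pdf_n : p n%:R @[n --> \oo] --> (0 : R).
Proof.
under eq_fun do rewrite normal_pdf0E.
rewrite -(mulr0 (normal_peak s)); apply: cvgMr.
have c : 0 < s ^- 2 / 2 by rewrite divr_gt0// invr_gt0 exprn_gt0.
under eq_fun do rewrite mulNr.
apply: (@cvg_comp _ _ _ (fun n : nat => n%:R : R)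
  (fun x : R => expR (- (s ^- 2 / 2 * x ^+ 2))) _ (pinfty_nbhs R)).
  exact: cvgr_idn.
apply: (@cvg_comp _ _ _ (fun x : R => s ^- 2 / 2 * x ^+ 2)
  (fun x : R => expR (- x)) _ (pinfty_nbhs R)); last exact: cvgr_expR.
by apply: gt0_cvgMry => //; exact: cvgr_expr2.
Qed.

Lemma continuous_normal_pdf0 : continuous p.
Proof. by apply: continuous_normal_pdf; rewrite gt_eqF. Qed.

Lemma integrable_x_sin_normal_pdf q c :
  mu.-integrable setT (EFin \o (fun x => x * sin (q * x + c) * p x)).
Proof.
apply: (@le_integrable _ _ R mu setT measurableT _ _ _ _
  integrable_abs_normal_pdf).
  apply/measurable_EFinP/measurable_funM; last exact: measurable_normal_pdf.
  by apply: measurable_funM => //; exact: measurable_sin_affine.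
move=> x _ /=; rewrite lee_fin !normrM normr_id ler_wpM2r//.
by rewrite ler_piMr// sin_max.
Qed.

(** Integration by parts, because the density p satisfies p' = - x p / s^2. *)
Lemma Rintegral_sin_x_normal_pdf q c :
  \int[mu]_x (x * sin (q * x + c) * p x) =
  s ^+ 2 * q * \int[mu]_x (cos (q * x + c) * p x).
Proof.
pose h x := q * (cos (q * x + c) * p x) - s ^- 2 * (x * sin (q * x + c) * p x).
have i1 : mu.-integrable setT (EFin \o (fun x => cos (q * x + c) * p x)).
  by apply: (@integrable_mul_normal_pdf _ _ _ _ 1) => [|x];
    [exact: measurable_cos_affine|exact: cos_max].
have i2 := integrable_x_sin_normal_pdf q c.
have : \int[mu]_x h x = 0.
  apply: (@Rintegral_derive_eq0 (fun x => sin (q * x + c) * p x)).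
  - move=> x.
    rewrite (_ : h x = sin (q * x + c) *: (- (s ^- 2) * x * p x)
      + p x *: (q * cos (q * x + c))).
      exact: (is_deriveM (is_derive_sin_affine q c x) (is_derive_normal_pdf x)).
    by rewrite /h /GRing.scale/=; ring.
  - move=> x; apply: cvgB; apply: cvgMr.
      apply: cvgM; last exact: continuous_normal_pdf0.
      exact: continuous_cos_affine.
    apply: cvgM; last exact: continuous_normal_pdf0.
    apply: cvgM; first exact: cvg_id.
    exact: continuous_sin_affine.
  - by apply: integrable_sub => //; exact: integrable_scale.
  - apply/cvgr0Pnorm_le => e e0.
    have e2 : 0 < e / 2 by rewrite divr_gt0.
    have /cvgr0Pnorm_le/(_ _ e2) := cvg_normal_pdf_n.
    apply: filterS => n pn.
    have -> : p (- n%:R) = p n%:R by rewrite !normal_pdf0E sqrrN.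
    rewrite -mulrBl normrM (le_trans (_ : _ <= 2 * `|p n%:R|))//; last first.
      by rewrite -ler_pdivlMl// mulrC.
    rewrite ler_wpM2r// (le_trans (ler_normB _ _))//.
    by rewrite (_ : 2 = 1 + 1)// lerD// sin_max.
rewrite /h RintegralB//; [|exact: integrable_scale..].
rewrite !RintegralZl//.
move/subr0_eq => e; apply: (mulfI (_ : s ^- 2 != 0)).
  by rewrite invr_eq0 expf_eq0/= gt_eqF.
by rewrite -e; field; rewrite gt_eqF.
Qed.

Lemma is_derive_normal_fourier q c :
  is_derive q 1 (fun r => \int[mu]_x (cos (r * x + c) * p x))
    (- (s ^+ 2 * q * \int[mu]_x (cos (q * x + c) * p x))).
Proof.
pose f (r : R) (x : R) := cos (r * x + c) * p x.
have df (r x : R) :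
    is_derive r 1 (fun r : R => f r x) (- (x * sin (r * x + c) * p x)).
  rewrite (_ : - _ = p x *: (- x * sin (x * r + c))).
    have := is_deriveZ (p x) (is_derive_cos_affine x c r).
    congr (is_derive _ _ _ _); apply/funext => y.
    by rewrite /f [y * x]mulrC [RHS]mulrC.
  by rewrite /GRing.scale/= [r * x]mulrC; ring.
have d1E r x : partial1of2 f r x = - (x * sin (r * x + c) * p x).
  by rewrite partial1of2E; have [_ ->] := df r x.
pose I := `]q - 1, q + 1[%classic : set R.
have qI : I q by rewrite /I/= in_itv/=; lra.
have intf r : I r -> mu.-integrable setT (EFin \o f r).
  by move=> _; apply: (@integrable_mul_normal_pdf _ _ _ _ 1) => [|x];
    [exact: measurable_cos_affine|exact: cos_max].
have df' r x : I r -> setT x -> derivable (f ^~ x) r 1.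
  by move=> _ _; have [] := df r x.
have G0 x : 0 <= `|x| * p x by rewrite mulr_ge0 ?normal_pdf_ge0.
have GB r x : I r -> setT x ->
    `|partial1of2 f r x| <= `|x| * p x.
  move=> _ _; rewrite d1E normrN !normrM.
  by rewrite (ger0_norm (normal_pdf_ge0 _ _ _)) ler_wpM2r ?normal_pdf_ge0//
    ler_piMr// sin_max.
apply: DeriveDef.
  exact: (derivable_under_integral measurableT qI intf df' G0
    integrable_abs_normal_pdf GB).
rewrite -derive1E (differentiation_under_integral measurableT qI intf df' G0
  integrable_abs_normal_pdf GB).
rewrite -Rintegral_sin_x_normal_pdf -mulN1r -RintegralZl//; last first.
  exact: integrable_x_sin_normal_pdf.
by apply: eq_Rintegral => x _; rewrite d1E mulN1r.
Qed.

(** The integral F(q) solves F' = - s^2 q F, so that F(q) exp(s^2 q^2 / 2) does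
    not depend on q. The phase c makes one computation serve for the cosine (c
    = 0) and for the sine (c = - pi / 2). *)
Lemma normal_fourier q c :
  \int[mu]_x (cos (q * x + c) * p x) = cos c * expR (- (s ^+ 2 * q ^+ 2 / 2)).
Proof.
pose F r := \int[mu]_x (cos (r * x + c) * p x).
pose E (r : R) := expR (s ^+ 2 / 2 * r ^+ 2).
have dE (r : R) : is_derive r 1 E (E r * (s ^+ 2 * r)).
  apply: (@is_derive1_comp _ expR).
  rewrite (_ : s ^+ 2 * r = (s ^+ 2 / 2) *: ((2 * r ^+ 1) *: 1)).
    exact: (is_deriveZ _ (is_deriveX 2 (is_derive_id r (1 : R)))).
  by rewrite expr1 /GRing.scale/=; field.
have d0 (r : R) : is_derive r 1 (F * E) 0.
  rewrite (_ : 0 = F r *: (E r * (s ^+ 2 * r)) +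
      E r *: (- (s ^+ 2 * r * F r))).
    exact: (is_deriveM (is_derive_normal_fourier r c) (dE r)).
  by rewrite /GRing.scale/=; ring.
have FE : F q * E q = F 0 * E 0 := is_derive_0_is_cst q 0 d0.
have F0 : F 0 = cos c.
  rewrite /F; under eq_Rintegral do rewrite mul0r add0r.
  rewrite RintegralZl//; last exact: integrable_normal_pdf.
  by rewrite /Rintegral integral_normal_pdf mulr1.
have E0 : E 0 = 1 by rewrite /E expr0n/= mulr0 expR0.
rewrite -/(F q) expRN (_ : cos c = F q * E q); last by rewrite FE F0 E0 mulr1.
rewrite (_ : s ^+ 2 * q ^+ 2 / 2 = s ^+ 2 / 2 * q ^+ 2); last by field.
by rewrite -/(E q) mulfK// gt_eqF// expR_gt0.
Qed.

Lemma normal_char_cos q :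
  \int[normal_prob 0 s]_x cos (q * x) = expR (- (s ^+ 2 * q ^+ 2 / 2)).
Proof.
rewrite Rintegral_normal_prob; last first.
  apply: (@integrable_bounded _ _ _ _ _ 1) => [|x]; last exact: cos_max.
  exact: measurable_scale_cos.
under eq_Rintegral do rewrite -[q * _]addr0.
by rewrite normal_fourier cos0 mul1r.
Qed.

Lemma normal_char_sin q : \int[normal_prob 0 s]_x sin (q * x) = 0.
Proof.
rewrite Rintegral_normal_prob; last first.
  apply: (@integrable_bounded _ _ _ _ _ 1) => [|x]; last exact: sin_max.
  exact: measurable_scale_sin.
under eq_Rintegral do rewrite -cosBpihalf.
by rewrite normal_fourier cosN cos_pihalf mul0r.
Qed.

End fixed_variance.
End gaussian_fourier.

(** * Levy's continuity theorem *)

Section uniform_continuity.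
Context {R : realType}.

(** On the segment of radius |K| + 1 this is the Heine-Cantor theorem; of two
    points at distance at most 1, if one is outside this segment then g
    vanishes at both. *)
Lemma compact_support_unif_continuous (g : R -> R) (K : R) :
  continuous g -> (forall x, K <= `|x| -> g x = 0) ->
  forall e, 0 < e -> exists2 d, 0 < d &
    forall x y, `|y - x| <= d -> `|g y - g x| <= e.
Proof.
move=> cg g0 e e0.
have e2 : 0 < e / 2 by rewrite divr_gt0.
pose A := `[- (`|K| + 1), `|K| + 1]%classic : set R.
have near_g x : A x -> \forall x' \near x & d \near (0 : R)^'+,
    forall y, `|y - x'| <= d -> `|g y - g x'| <= e.
  move=> _; have /cvgrPdist_le/(_ _ e2)/nbhs_ballP[r/= r0 gr] := cg x.
  have r2 : 0 < r / 2 by rewrite divr_gt0.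
  exists (ball x (r / 2), [set d | d < r / 2]); first split => /=.
  - exact: nbhsx_ballx.
  - exact: nbhs_right_lt.
  - move=> [x' d] [/= xx' dr] y yd.
    rewrite (_ : g y - g x' = (g x - g x') - (g x - g y)); last by ring.
    rewrite (le_trans (ler_normB _ _))// (splitr e) lerD// gr//.
      by apply: le_ball xx'; rewrite ler_pdivrMr// ler_peMr// ?ler1n// ltW.
    apply: (@ball_splitr _ _ x'); first exact: ball_sym.
    by rewrite /ball/= distrC (le_lt_trans yd).
have H : \forall d \near (0 : R)^'+,
    A `<=` (fun x' => forall y, `|y - x'| <= d -> `|g y - g x'| <= e).
  have /compact_near_coveringP cA : compact A by exact: segment_compact.
  exact: cA near_g.
near (0 : R)^'+ => d.
exists d => [//|x y xyd].
have [xK|xK] := leP `|x| (`|K| + 1).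
  have : A `<=` (fun x' => forall y, `|y - x'| <= d -> `|g y - g x'| <= e).
    by near: d.
  by apply=> //; rewrite /A/= in_itv/= -ler_norml.
have d1 : d <= 1 by near: d; exact: nbhs_right_le.
have KK := ler_norm K.
have := ler_normD y (x - y); rewrite addrC subrK distrC => xy.
by rewrite !g0 ?subrr ?normr0 ?ltW//; lra.
Unshelve. all: by end_near. Qed.

End uniform_continuity.

Section gaussian_smoothing.
Context {R : realType}.
Notation mu := (@lebesgue_measure R).
Notation prob := (probability (measurableTypeR R) R).
Implicit Types (P Q : prob) (g : R -> R) (s x y : R).

(** The Gaussian is its own Fourier transform: up to the factor [normal_peak
    s], the density with standard deviation s is the characteristic function of
    the Gaussian with standard deviation 1 / s. *)
Lemma normal_pdf_fourier s x y : 0 < s ->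
  normal_pdf x s y =
  normal_peak s * \int[normal_prob 0 s^-1]_u cos ((y - x) * u).
Proof.
move=> s0; rewrite normal_char_cos ?invr_gt0//.
rewrite normal_pdfE ?gt_eqF// /normal_fun; congr (_ * expR _).
by rewrite -mulr_natr; field; rewrite gt_eqF.
Qed.

Lemma normal_peakV s : 0 < s -> normal_peak s = s^-1 * (Num.sqrt (pi *+ 2))^-1.
Proof.
move=> s0; rewrite /normal_peak -mulrnAr sqrtrM ?sqr_ge0// sqrtr_sqr.
by rewrite gtr0_norm// invfM.
Qed.

(** The product of two Gaussians with the same centre is a multiple of the
    Gaussian with standard deviation s / sqrt(1 + s^2). *)
Lemma Rintegral_gauss_normal_pdf s x : 0 < s ->
  \int[mu]_y (expR (- ((y - x) ^+ 2 / 2)) * normal_pdf x s y) =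
  (Num.sqrt (1 + s ^+ 2))^-1.
Proof.
move=> s0; set c := Num.sqrt _.
have c0 : 0 < c by rewrite sqrtr_gt0 ltr_pwDl// sqr_ge0.
have c2 : c ^+ 2 = 1 + s ^+ 2.
  by rewrite sqr_sqrtr// addr_ge0// sqr_ge0.
have sc0 : 0 < s / c by rewrite divr_gt0.
have pi0 : Num.sqrt (pi *+ 2) != 0 :> R.
  by rewrite gt_eqF// sqrtr_gt0 mulrn_wgt0// pi_gt0.
transitivity (\int[mu]_y (c^-1 * normal_pdf x (s / c) y)).
  apply: eq_Rintegral => y _.
  rewrite !normal_pdfE ?gt_eqF// /normal_fun.
  rewrite mulrCA -expRD !normal_peakV// mulrA; congr (_ * expR _).
    by field; rewrite pi0 !gt_eqF.
  rewrite -(mulr_natr (s ^+ 2)) -(mulr_natr ((s / c) ^+ 2)) expr_div_n c2; field.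
  by rewrite !gt_eqF// ltr_pwDl// sqr_ge0.
rewrite RintegralZl//; last exact: integrable_normal_pdf.
by rewrite /Rintegral integral_normal_pdf mulr1.
Qed.

(** Where |y - x| > d, the bound |g y - g x| <= 2 M is at most a multiple C of
    1 - exp(- (y - x)^2 / 2). The Gaussian average of this function around x is
    1 - 1 / sqrt(1 + s^2), which does not depend on x and vanishes with s. *)
Lemma smoothing_error g (M : R) : continuous g -> (forall x, `|g x| <= M) ->
  (forall e, 0 < e -> exists2 d, 0 < d &
    forall x y, `|y - x| <= d -> `|g y - g x| <= e) ->
  forall e, 0 < e -> exists2 s, 0 < s & forall x,
    `|\int[mu]_y (g y * normal_pdf x s y) - g x| <= e.
Proof.
move=> cg gM gu e e0.
have M0 : 0 <= M by rewrite (le_trans _ (gM 0)).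
have e2 : 0 < e / 2 by rewrite divr_gt0.
have [d d0 gd] := gu _ e2.
have mg : measurable_fun setT g by exact: continuous_measurable_fun.
pose k := 1 - expR (- (d ^+ 2 / 2)).
have k0 : 0 < k by rewrite subr_gt0 expR_lt1 oppr_lt0 divr_gt0// exprn_gt0.
pose C := 2 * M / k.
have C0 : 0 <= C by rewrite divr_ge0 ?mulr_ge0// ltW.
have bnd x y : `|g y - g x| <= e / 2 + C * (1 - expR (- ((y - x) ^+ 2 / 2))).
  have E1 z : expR (- (z ^+ 2 / 2)) <= 1 :> R.
    by rewrite -[leRHS]expR0 ler_expR oppr_le0 divr_ge0// sqr_ge0.
  have [yd|yd] := leP `|y - x| d.
    rewrite (le_trans (gd _ _ yd))// lerDl mulr_ge0// subr_ge0; exact: E1.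
  apply: (@le_trans _ _ (C * k)).
    rewrite /C divfK ?gt_eqF//.
    by rewrite (le_trans (ler_normB _ _))// mulr_natl mulr2n lerD.
  rewrite (@le_trans _ _ (C * (1 - expR (- ((y - x) ^+ 2 / 2)))))//; last first.
    by rewrite lerDr ltW.
  rewrite ler_wpM2l// lerD2l lerN2 ler_expR lerN2 ler_pM2r//.
  rewrite -(real_normK (num_real (y - x))) lerXn2r// ?nnegrE//; exact: ltW.
have /cvgrPdist_le/(_ (e / 2 / (C + 1))) :
    (Num.sqrt (1 + s ^+ 2))^-1 @[s --> (0:R)^'+] --> (1 : R).
  apply: cvg_at_right_filter.
  rewrite -[X in _ --> X]invr1; apply: cvgV; first exact: oner_neq0.
  rewrite -[X in _ --> X]sqrtr1; apply: continuous_cvg.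
    exact: sqrt_continuous.
  rewrite -[X in _ --> X]addr0; apply: cvgD; first exact: cvg_cst.
  rewrite -[X in _ --> X](expr0n R 2).
  exact: exprn_continuous.
have C1 : 0 < C + 1 by rewrite ltr_wpDl.
move=> /(_ (divr_gt0 e2 C1)) H; near (0:R)^'+ => s.
have s0 : 0 < s by near: s; exact: nbhs_right_gt.
exists s => // x.
have -> : \int[mu]_y (g y * normal_pdf x s y) - g x =
    \int[mu]_y ((g y - g x) * normal_pdf x s y).
  under [RHS]eq_Rintegral do rewrite mulrBl.
  rewrite RintegralB//.
  - rewrite RintegralZl//; last exact: integrable_normal_pdf.
    by rewrite [X in _ = _ - _ * X]/Rintegral integral_normal_pdf mulr1.
  - exact: (integrable_mul_normal_pdf _ _ mg gM).
  - by apply: (@integrable_mul_normal_pdf _ _ _ _ `|g x|).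
have iE : mu.-integrable setT (EFin \o (fun y =>
    expR (- ((y - x) ^+ 2 / 2)) * normal_pdf x s y)).
  apply: (@integrable_mul_normal_pdf _ _ _ _ 1) => //.
    do 2 apply: measurableT_comp => //=.
    apply: measurable_funM => //=; apply: measurable_funX => //=.
    exact: measurable_funB.
  move=> y; rewrite ger0_norm ?expR_ge0//.
  by rewrite -[leRHS]expR0 ler_expR oppr_le0 divr_ge0// sqr_ge0.
have i1 : mu.-integrable setT (EFin \o (fun y => (e / 2 + C) * normal_pdf x s y)).
  by apply: (@integrable_mul_normal_pdf _ _ _ _ `|e / 2 + C|).
have i2 : mu.-integrable setT (EFin \o (fun y =>
    C * (expR (- ((y - x) ^+ 2 / 2)) * normal_pdf x s y))).
  exact: integrable_scale.
have ig : mu.-integrable setT (EFin \o (fun y => (g y - g x) * normal_pdf x s y)).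
  apply: (@integrable_mul_normal_pdf _ _ _ _ (M + M)) => //.
    exact: measurable_funB.
  by move=> y; rewrite (le_trans (ler_normB _ _))// lerD.
apply: (le_trans (le_normr_Rintegral measurableT ig)).
apply: (@le_trans _ _ (\int[mu]_y ((e / 2 + C) * normal_pdf x s y -
    C * (expR (- ((y - x) ^+ 2 / 2)) * normal_pdf x s y)))).
  apply: le_Rintegral => //.
  - exact: (integrable_norm ig).
  - exact: integrable_sub.
  - move=> y _; rewrite normrM (ger0_norm (normal_pdf_ge0 _ _ _)).
    rewrite mulrA -mulrBl ler_wpM2r ?normal_pdf_ge0//.
    by rewrite (le_trans (bnd x y))// mulrBr mulr1 addrA.
rewrite RintegralB// !RintegralZl//; last exact: integrable_normal_pdf.
rewrite Rintegral_gauss_normal_pdf// [X in _ * X - _]/Rintegral.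
rewrite integral_normal_pdf mulr1.
have : `|1 - (Num.sqrt (1 + s ^+ 2))^-1| <= e / 2 / (C + 1) by near: s.
rewrite ler_pdivlMr//; set w := _^-1 => hw.
have : C * (1 - w) <= `|1 - w| * (C + 1).
  rewrite [leRHS]mulrDr mulr1 [leLHS]mulrC ler_wpDr// ler_wpM2r//.
  exact: ler_norm.
by move: hw; lra.
Unshelve. all: by end_near. Qed.

Lemma normal_pdf_sym s x y : 0 < s -> normal_pdf x s y = normal_pdf y s x.
Proof.
move=> s0; rewrite !normal_pdfE ?gt_eqF// /normal_fun.
by rewrite (_ : (y - x) ^+ 2 = (x - y) ^+ 2)//; ring.
Qed.

Lemma measurable_normal_pdf_mean s y : 0 < s ->
  measurable_fun setT (fun x => normal_pdf x s y).
Proof.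
move=> s0; have -> : (fun x => normal_pdf x s y) = normal_pdf y s.
  by apply/funext => x; exact: normal_pdf_sym.
exact: measurable_normal_pdf.
Qed.

End gaussian_smoothing.

Section levy.
Context {R : realType}.
Notation mu := (@lebesgue_measure R).
Notation prob := (probability (measurableTypeR R) R).
Implicit Types (P Q : prob) (g : R -> R) (s x y : R).

Lemma Rintegral_cos_shift P y u :
  \int[P]_x cos ((y - x) * u) =
  cos (y * u) * \int[P]_x cos (u * x) + sin (y * u) * \int[P]_x sin (u * x).
Proof.
have iC : P.-integrable setT (EFin \o (fun x => cos (u * x))).
  apply: (@integrable_bounded _ _ _ _ _ 1) => [|x]; last exact: cos_max.
  exact: measurable_scale_cos.
have iS : P.-integrable setT (EFin \o (fun x => sin (u * x))).
  apply: (@integrable_bounded _ _ _ _ _ 1) => [|x]; last exact: sin_max.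
  exact: measurable_scale_sin.
rewrite -!RintegralZl// -RintegralD//; [|exact: integrable_scale..].
by apply: eq_Rintegral => x _; rewrite mulrBl cosB [x * u]mulrC.
Qed.

Lemma measurable_cos_shift y u :
  measurable_fun setT (fun x : R => cos ((y - x) * u)).
Proof.
have -> : (fun x : R => cos ((y - x) * u)) = (fun x => cos (- u * x + y * u)).
  by apply/funext => x; congr cos; ring.
exact: measurable_cos_affine.
Qed.

Lemma integrable_prod_cos_shift (P Q : prob) y :
  (P \x Q)%E.-integrable setT (EFin \o (fun z => cos ((y - z.2) * z.1))).
Proof.
apply: (@integrable_bounded _ _ _ (P \x Q)%E _ 1); last first.
  by move=> z; exact: cos_max.
apply: (measurableT_comp (f := cos)).
  by apply: continuous_measurable_fun; exact: continuous_cos.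
apply: measurable_funM; last exact: measurable_fst.
by apply: measurable_funB => //; exact: measurable_snd.
Qed.

(** Density of the convolution of P with the centred Gaussian of standard
    deviation s. *)
Definition smoothed_density s P y := \int[P]_x normal_pdf x s y.

(** Fourier inversion: by Fubini's theorem the smoothed density is a Gaussian
    average of the characteristic function of P, in view of
    [Rintegral_cos_shift]. *)
Lemma smoothed_densityE s P y : 0 < s ->
  smoothed_density s P y = normal_peak s *
    \int[normal_prob 0 s^-1]_u \int[P]_x cos ((y - x) * u).
Proof.
move=> s0; rewrite /smoothed_density.
under eq_Rintegral do rewrite normal_pdf_fourier//.
pose G : prob := normal_prob 0 s^-1.
have ijoint := integrable_prod_cos_shift G P y.
have i1 u : P.-integrable setT (EFin \o (fun x => cos ((y - x) * u))).
  apply: (@integrable_bounded _ _ _ P _ 1) => [|x]; last exact: cos_max.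
  exact: measurable_cos_shift.
have i2 x : G.-integrable setT (EFin \o (fun u => cos ((y - x) * u))).
  apply: (@integrable_bounded _ _ _ G _ 1) => [|u]; last exact: cos_max.
  exact: measurable_scale_cos.
have := Rintegral_fubini ijoint i1 i2 => /= E.
rewrite RintegralZl//; first by rewrite E.
apply: (@integrable_bounded _ _ _ P _ 1).
  exact: (measurable_Rintegral_fubini2 ijoint).
move=> x; apply: (le_norm_Rintegral_prob G) => [|u]; last exact: cos_max.
exact: measurable_scale_cos.
Qed.

Lemma cvg_smoothed_density s (P_ : nat -> prob) P y : 0 < s ->
  (forall q, \int[P_ n]_x cos (q * x) @[n --> \oo] --> \int[P]_x cos (q * x)) ->
  (forall q, \int[P_ n]_x sin (q * x) @[n --> \oo] --> \int[P]_x sin (q * x)) ->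
  smoothed_density s (P_ n) y @[n --> \oo] --> smoothed_density s P y.
Proof.
move=> s0 hC hS.
rewrite smoothed_densityE//; under eq_fun do rewrite smoothed_densityE//.
apply: cvgMr.
pose G : prob := normal_prob 0 s^-1.
have mI Q : measurable_fun setT (fun u : R => \int[Q]_x cos ((y - x) * u)).
  exact: (measurable_Rintegral_fubini (integrable_prod_cos_shift G Q y)).
apply: (@dominated_cvg_Rintegral _ _ R G
  (fun n u => \int[P_ n]_x cos ((y - x) * u)) _ (cst 1)) => //.
- by move=> n; exact: mI.
- exact: mI.
- move=> u; rewrite Rintegral_cos_shift.
  rewrite (_ : (fun n => _) = (fun n => cos (y * u) * \int[P_ n]_x cos (u * x) +
      sin (y * u) * \int[P_ n]_x sin (u * x))); last first.
    by apply/funext => n; exact: Rintegral_cos_shift.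
  by apply: cvgD; apply: cvgMr.
- by apply: (@integrable_bounded _ _ _ G _ 1) => // x /=; rewrite normr1.
- move=> n u; apply: le_norm_Rintegral_prob => [|x]; last exact: cos_max.
  exact: measurable_cos_shift.
Qed.

Lemma smoothed_density_ge0 s P y : 0 <= smoothed_density s P y.
Proof. by apply: Rintegral_ge0 => x _; exact: normal_pdf_ge0. Qed.

Lemma smoothed_density_le s P y : 0 < s ->
  smoothed_density s P y <= normal_peak s.
Proof.
move=> s0; rewrite (le_trans (ler_norm _))//; apply: le_norm_Rintegral_prob.
  exact: measurable_normal_pdf_mean.
by move=> x; rewrite ger0_norm ?normal_pdf_ge0// normal_pdf_ub// gt_eqF.
Qed.

Lemma integrable_prod_normal_pdf g (M : R) P s : 0 < s ->
  measurable_fun setT g -> (forall y, `|g y| <= M) ->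
  (mu \x P)%E.-integrable setT
    (EFin \o (fun z : R * R => g z.1 * normal_pdf z.2 s z.1)).
Proof.
move=> s0 mg gM.
have M0 : 0 <= M by rewrite (le_trans _ (gM 0)).
have mf : measurable_fun setT (fun z : R * R => g z.1 * normal_pdf z.2 s z.1).
  apply: measurable_funM.
    by apply: (measurableT_comp mg); exact: measurable_fst.
  under eq_fun do rewrite normal_pdfE ?gt_eqF// /normal_fun.
  apply: measurable_funM => //; apply: measurableT_comp => //.
  apply: measurable_funM => //; apply: measurableT_comp => //.
  apply: measurable_funX; apply: measurable_funB.
    exact: measurable_fst.
  exact: measurable_snd.
have mF : measurable_fun setT
  (EFin \o (fun z : R * R => g z.1 * normal_pdf z.2 s z.1)).
  exact/measurable_EFinP.
apply: (@integrable21ltyP _ _ _ _ R mu P _ mF).2.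
apply: (@le_lt_trans _ _ (\int[P]_x M%:E)%E); last first.
  by rewrite integral_cst// lte_mul_pinfty// -ge0_fin_numE// fin_num_measure.
apply: ge0_le_integral => //.
- by move=> x _; apply: integral_ge0.
- apply: (@measurable_fun_fubini_tonelli_G _ _ _ _ R mu
    (abse \o (EFin \o (fun z : R * R => g z.1 * normal_pdf z.2 s z.1)))).
    by apply: measurableT_comp.
  by move=> z; exact: abse_ge0.
- move=> x _.
  apply: (@le_trans _ _ (\int[mu]_y (M * normal_pdf x s y)%:E)%E); last first.
    under eq_integral do rewrite EFinM.
    rewrite integralZl//; last exact: integrable_normal_pdf.
    by rewrite integral_normal_pdf mule1.
  apply: ge0_le_integral => //.
  + apply: measurableT_comp => //; apply/measurable_EFinP.
    by apply: measurable_funM => //; exact: measurable_normal_pdf.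
  + apply/measurable_EFinP.
    by apply: measurable_funM => //; exact: measurable_normal_pdf.
  + move=> y _ /=; rewrite lee_fin normrM (ger0_norm (normal_pdf_ge0 _ _ _)).
    by rewrite ler_wpM2r ?normal_pdf_ge0.
Qed.

(** By Fubini's theorem the smoothing can be moved from the measure to g. *)
Lemma Rintegral_smoothed g (M : R) P s : 0 < s ->
  measurable_fun setT g -> (forall y, `|g y| <= M) ->
  \int[mu]_y (g y * smoothed_density s P y) =
  \int[P]_x \int[mu]_y (g y * normal_pdf x s y).
Proof.
move=> s0 mg gM.
have i := integrable_prod_normal_pdf P s0 mg gM.
have i1 y : P.-integrable setT (EFin \o (fun x => normal_pdf x s y)).
  apply: (@integrable_bounded _ _ _ _ _ (normal_peak s)) => [|x]; last first.
    by rewrite ger0_norm ?normal_pdf_ge0// normal_pdf_ub// gt_eqF.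
  exact: measurable_normal_pdf_mean.
have iZ y : P.-integrable setT (EFin \o (fun x => g y * normal_pdf x s y)).
  exact: integrable_scale.
have i2 x : mu.-integrable setT (EFin \o (fun y => g y * normal_pdf x s y)).
  exact: (integrable_mul_normal_pdf _ _ mg gM).
rewrite -(Rintegral_fubini i iZ i2); apply: eq_Rintegral => y _.
by rewrite /= RintegralZl.
Qed.

(** Replacing g by its smoothing costs little, uniformly in the measure
    ([smoothing_error]). After that only the smoothed densities matter: they
    converge pointwise, and the compact support of g provides the
    domination. *)
Lemma levy_continuity_compact_support (P_ : nat -> prob) P g (K : R) :
  (forall q, \int[P_ n]_x cos (q * x) @[n --> \oo] --> \int[P]_x cos (q * x)) ->
  (forall q, \int[P_ n]_x sin (q * x) @[n --> \oo] --> \int[P]_x sin (q * x)) ->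
  continuous g -> (forall x, K <= `|x| -> g x = 0) -> bounded_function g ->
  \int[P_ n]_x g x @[n --> \oo] --> \int[P]_x g x.
Proof.
move=> hC hS cg g0 [M gM].
have M0 : 0 <= M by rewrite (le_trans _ (gM 0)).
have mg : measurable_fun setT g by exact: continuous_measurable_fun.
apply/cvgrPdist_le => e e0; have e3 : 0 < e / 3 by rewrite divr_gt0.
have [s s0 sg] := smoothing_error cg gM (compact_support_unif_continuous cg g0) e3.
have err Q : `|\int[mu]_y (g y * smoothed_density s Q y) - \int[Q]_x g x| <= e / 3.
  rewrite (Rintegral_smoothed Q s0 mg gM).
  have msm : measurable_fun setT (fun x => \int[mu]_y (g y * normal_pdf x s y)).
    exact: (measurable_Rintegral_fubini2 (integrable_prod_normal_pdf Q s0 mg gM)).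
  rewrite -RintegralB//.
  - by apply: le_norm_Rintegral_prob => //; exact: measurable_funB.
  - apply: (@integrable_bounded _ _ _ Q _ (M + e / 3)) => // x.
    have := sg x; have := gM x; set A := Rintegral _ _ _ => gx Ax.
    rewrite -[A](subrK (g x)) addrC (le_trans (ler_normD _ _))//.
    exact: lerD.
  - exact: (integrable_bounded Q mg gM).
have : \int[mu]_y (g y * smoothed_density s (P_ n) y) @[n --> \oo] -->
       \int[mu]_y (g y * smoothed_density s P y).
  have msd Q : measurable_fun setT (smoothed_density s Q).
    have m1 : measurable_fun setT (cst 1 : R -> R) by [].
    have b1 (y : R) : `|(cst 1 : R -> R) y| <= 1 by rewrite /= normr1.
    have := measurable_Rintegral_fubini (integrable_prod_normal_pdf Q s0 m1 b1).
    by under eq_fun do under eq_Rintegral do rewrite /= mul1r.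
  apply: (@dominated_cvg_Rintegral _ _ R mu
    (fun n y => g y * smoothed_density s (P_ n) y) _
    (fun y => M * normal_peak s * \1_(`[- K, K]%classic) y)).
  - by move=> n; exact: (measurable_funM mg (msd _)).
  - exact: (measurable_funM mg (msd _)).
  - by move=> y; apply: cvgMr; exact: cvg_smoothed_density.
  - by apply: integrable_scale => //; exact: integrable_indic_itv.
  - move=> n y; rewrite normrM (ger0_norm (smoothed_density_ge0 _ _ _)).
    have [yK|yK] := leP `|y| K; last first.
      by rewrite (g0 _ (ltW yK)) normr0 mul0r !mulr_ge0// normal_peak_ge0.
    rewrite indicE mem_set ?mulr1; last by rewrite /= in_itv/= -ler_norml.
    by rewrite ler_pM// ?smoothed_density_ge0// smoothed_density_le.
move/cvgrPdist_le => /(_ _ e3); apply: filterS => n.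
have := err P; have := err (P_ n).
set a := \int[P_ n]_x _; set b := \int[P]_x _; set c := Rintegral _ _ _.
set c' := Rintegral _ _ _ => h1 h2 h3.
rewrite (_ : b - a = - (c' - b) + (c' - c) + (c - a)); last by ring.
rewrite (le_trans (ler_normD _ _))// (_ : e = e / 3 + e / 3 + e / 3); last by field.
by rewrite lerD// (le_trans (ler_normD _ _))// lerD// normrN.
Qed.

Definition cutoff (K : R) (x : R) : R := Num.max 0 (Num.min 1 (K + 1 - `|x|)).

Lemma cutoff_ge0 K x : 0 <= cutoff K x.
Proof. by rewrite /cutoff le_max lexx. Qed.

Lemma cutoff_le1 K x : cutoff K x <= 1.
Proof. by rewrite /cutoff ge_max ler01/= ge_min lexx. Qed.

Lemma cutoff_out K x : K + 1 <= `|x| -> cutoff K x = 0.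
Proof.
by move=> Kx; apply/max_idPl; rewrite ge_min subr_le0 Kx orbT.
Qed.

Lemma cutoff_in K x : `|x| <= K -> cutoff K x = 1.
Proof.
move=> Kx; rewrite /cutoff (_ : Num.min _ _ = 1); first exact/max_idPr.
by apply/min_idPl; rewrite lerBrDr addrC lerD2r.
Qed.

Lemma continuous_cutoff K : continuous (cutoff K).
Proof.
move=> x; apply: (@continuous_max _ _ (cst 0)
  (cst 1 \min (fun x => K + 1 - `|x|))); first exact: cvg_cst.
apply: continuous_min; first exact: cvg_cst.
by apply: cvgB; [exact: cvg_cst|exact: norm_continuous].
Qed.

(** No mass escapes to infinity: P is a probability measure, so a wide enough
    cutoff has P-integral close to 1; the P_n-integrals of this cutoff converge
    to it, which bounds the mass of P_n outside a compact set. *)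
Theorem levy_continuity (P_ : nat -> prob) P g :
  (forall q, \int[P_ n]_x cos (q * x) @[n --> \oo] --> \int[P]_x cos (q * x)) ->
  (forall q, \int[P_ n]_x sin (q * x) @[n --> \oo] --> \int[P]_x sin (q * x)) ->
  continuous g -> bounded_function g ->
  \int[P_ n]_x g x @[n --> \oo] --> \int[P]_x g x.
Proof.
move=> hC hS cg [M gM].
have M0 : 0 <= M by rewrite (le_trans _ (gM 0)).
have mg : measurable_fun setT g by exact: continuous_measurable_fun.
have mc K : measurable_fun setT (cutoff K).
  by apply: continuous_measurable_fun; exact: continuous_cutoff.
have nc K x : `|cutoff K x| <= 1 by rewrite ger0_norm ?cutoff_ge0 ?cutoff_le1.
have ic Q K : Q.-integrable setT (EFin \o cutoff K).
  exact: (integrable_bounded Q (mc K) (nc K)).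
have tails Q K : `|\int[Q]_x g x - \int[Q]_x (g x * cutoff K x)| <=
    M * (1 - \int[Q]_x cutoff K x).
  have ig : Q.-integrable setT (EFin \o g).
    exact: (integrable_bounded Q mg gM).
  have igc : Q.-integrable setT (EFin \o (fun x => g x * cutoff K x)).
    apply: (@integrable_bounded _ _ _ Q _ M) => [|x].
      by apply: measurable_funM => //; exact: mc.
    by rewrite normrM -[leRHS]mulr1 ler_pM.
  have i1c : Q.-integrable setT (EFin \o (fun x => 1 - cutoff K x)).
    apply: (@integrable_bounded _ _ _ Q _ 1) => [|x].
      by apply: measurable_funB => //; exact: mc.
    by rewrite ger0_norm ?subr_ge0 ?cutoff_le1// gerBl cutoff_ge0.
  have i1 : Q.-integrable setT (EFin \o (fun=> 1)).
    by apply: (@integrable_bounded _ _ _ Q _ 1) => // x; rewrite normr1.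
  rewrite -RintegralB//.
  have -> : M * (1 - \int[Q]_x cutoff K x) = \int[Q]_x (M * (1 - cutoff K x)).
    rewrite RintegralZl// RintegralB//; last exact: ic.
    by congr (_ * (_ - _)); exact/esym/Rintegral_prob_cst.
  have igs := integrable_sub measurableT ig igc.
  apply: (le_trans (le_normr_Rintegral measurableT igs)).
  apply: le_Rintegral => //.
  - exact: (integrable_norm igs).
  - exact: integrable_scale.
  - move=> x _; rewrite -{1}[g x]mulr1 -mulrBr normrM ler_pM//.
    by rewrite ger0_norm// subr_ge0 cutoff_le1.
apply/cvgrPdist_le => e e0; have e4 : 0 < e / 4 by rewrite divr_gt0.
have M1 : 0 < M + 1 by rewrite ltr_wpDl.
have : \int[P]_x cutoff k%:R x @[k --> \oo] --> (1 : R).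
  suff : \int[P]_x cutoff k%:R x @[k --> \oo] --> \int[P]_x (1 : R).
    by rewrite (Rintegral_prob_cst P 1).
  apply: (@dominated_cvg_Rintegral _ _ R P (fun k => cutoff k%:R) (fun=> 1)
    (fun=> 1)) => //.
  - by move=> k; exact: mc.
  - move=> x; apply: cvg_near_cst; near=> k; apply: cutoff_in.
    by near: k; exact: nbhs_infty_ger.
  - by apply: (@integrable_bounded _ _ _ P _ 1) => // x /=; rewrite normr1.
move=> /cvgrPdist_le/(_ (e / 4 / (M + 1))).
move=> /(_ (divr_gt0 e4 M1)) [k _ /(_ k (leqnn k))/= Pk].
have bc : bounded_function (cutoff (k%:R : R)) by exists 1 => x; exact: nc.
have bgc : bounded_function (fun x => g x * cutoff k%:R x).
  by exists M => x; rewrite normrM -[leRHS]mulr1 ler_pM.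
have c1 := levy_continuity_compact_support hC hS (@continuous_cutoff k%:R)
  (@cutoff_out k%:R) bc.
have c2 : \int[P_ n]_x (g x * cutoff k%:R x) @[n --> \oo] -->
    \int[P]_x (g x * cutoff k%:R x).
  apply: (levy_continuity_compact_support (K := k%:R + 1) hC hS _ _ bgc).
    by move=> x; apply: cvgM; [exact: cg|exact: continuous_cutoff].
  by move=> x xk; rewrite (cutoff_out xk) mulr0.
near=> n.
have h1 : `|\int[P]_x cutoff k%:R x - \int[P_ n]_x cutoff k%:R x| <= e / 4 / (M + 1).
  by near: n; move/cvgrPdist_le : c1; apply; exact: divr_gt0.
have h2 : `|\int[P]_x (g x * cutoff k%:R x) - \int[P_ n]_x (g x * cutoff k%:R x)| <= e / 4.
  by near: n; move/cvgrPdist_le : c2; apply.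
have h3 := tails P k%:R; have h4 := tails (P_ n) k%:R.
move: Pk h1 h2 h3 h4.
set u := \int[P]_x cutoff _ x; set v := \int[P_ n]_x cutoff _ x.
set a := \int[P]_x g x; set b := \int[P_ n]_x g x.
set a' := \int[P]_x (g x * _); set b' := \int[P_ n]_x (g x * _).
rewrite !ler_pdivlMr// => Pk h1 h2 h3 h4.
have MW w : M * w <= `|w| * (M + 1).
  rewrite [leRHS]mulrDr mulr1 ler_wpDr// [leRHS]mulrC ler_wpM2l//.
  exact: ler_norm.
have := MW (1 - u); have := MW (u - v).
rewrite (_ : a - b = (a - a') + (a' - b') - (b - b')); last by ring.
have := ler_normB ((a - a') + (a' - b')) (b - b').
have := ler_normD (a - a') (a' - b').
rewrite !mulrBr !mulr1 in h3 h4 *.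
lra.
Unshelve. all: by end_near. Qed.

End levy.

(** * Eigenfunctions of the generator *)

Section eigenfunctions.
Context {R : realType}.
Variables (lambda kappa gamma : R).
Hypotheses (hlambda : 0 <= lambda) (hkappa : 0 <= kappa) (hgamma : 0 < gamma).
Implicit Types (q c : R).

(** The root d of b d^2 - 2 gamma d + b = 0, with b = lambda sin q, that
    vanishes with q; this form of (gamma - sqrt(gamma^2 - b^2)) / b makes sense
    for b = 0. *)
Definition tilt q : R := lambda * sin q /
  (gamma + Num.sqrt (gamma ^+ 2 - (lambda * sin q) ^+ 2)).

Definition rt_eigenvalue q : R :=
  - ((lambda + 2 * kappa) * (1 - cos q)) - lambda * sin q * tilt q.

Definition speed (v : bool) : R := (velocity v)%:~R.

(** The real part of exp(i (q x + c)) (1 + i d v), where d is the tilt. The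
    phase c gives the imaginary part as well, for c = - pi / 2. *)
Definition rt_eigenfun q c (s : state) : R :=
  let: (x, v) := s in
  cos (q * x%:~R + c) - tilt q * speed v * sin (q * x%:~R + c).

Lemma norm_speed v : `|speed v| = 1.
Proof. by case: v; rewrite /speed /velocity ?expr1 ?expr0 ?normrN ?normr1. Qed.

Lemma tilt_denom_gt0 q :
  0 < gamma + Num.sqrt (gamma ^+ 2 - (lambda * sin q) ^+ 2).
Proof. by rewrite ltr_pwDl// sqrtr_ge0. Qed.

Lemma tilt_eq q : `|lambda * sin q| <= gamma ->
  lambda * sin q * tilt q ^+ 2 - 2 * gamma * tilt q + lambda * sin q = 0.
Proof.
move=> qg; rewrite /tilt; set b := lambda * sin q in qg *; set r := Num.sqrt _.
have r2 : r ^+ 2 = gamma ^+ 2 - b ^+ 2.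
  rewrite sqr_sqrtr// subr_ge0 -(real_normK (num_real b)).
  by rewrite lerXn2r// nnegrE// ltW.
have d0 : gamma + r != 0 by rewrite gt_eqF// ltr_pwDl// sqrtr_ge0.
rewrite (_ : _ + b = b * (r ^+ 2 - (gamma ^+ 2 - b ^+ 2)) / (gamma + r) ^+ 2).
  by rewrite r2 subrr mulr0 mul0r.
by field.
Qed.

Lemma tilt_mul_ge0 q : 0 <= lambda * sin q * tilt q.
Proof.
by rewrite /tilt mulrA -expr2 divr_ge0 ?sqr_ge0// ltW// tilt_denom_gt0.
Qed.

Lemma norm_tilt_le q : `|tilt q| <= lambda / gamma * `|sin q|.
Proof.
rewrite /tilt normrM normfV (ger0_norm (ltW (tilt_denom_gt0 q))).
rewrite normrM (ger0_norm hlambda) [leRHS]mulrAC ler_wpM2l ?mulr_ge0//.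
by rewrite lef_pV2 ?posrE ?tilt_denom_gt0// lerDl sqrtr_ge0.
Qed.

Lemma rt_eigenvalue_le0 q : rt_eigenvalue q <= 0.
Proof.
rewrite /rt_eigenvalue -opprD oppr_le0 addr_ge0 ?tilt_mul_ge0// mulr_ge0//.
by rewrite addr_ge0// mulr_ge0.
Qed.

(** The generator preserves the span of cos(q x + c) and v sin(q x + c). The
    coefficients of the cosine agree by definition of [rt_eigenvalue]; those of
    v sin(q x + c) agree because the tilt solves its quadratic equation. *)
Lemma rt_generator_eigenfun q c s : `|lambda * sin q| <= gamma ->
  rt_generator lambda kappa gamma (rt_eigenfun q c) s =
  rt_eigenvalue q * rt_eigenfun q c s.
Proof.
move=> /tilt_eq; case: s => x v; rewrite /rt_generator /rt_eigenfun /rt_eigenvalue.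
set d := tilt q => dE.
have E1 : q * (x + 1)%:~R + c = (q * x%:~R + c) + q.
  by rewrite intrD; ring.
have EN1 : q * (x - 1)%:~R + c = (q * x%:~R + c) - q.
  by rewrite intrB; ring.
set y := q * x%:~R + c in E1 EN1 *; clearbody y.
apply/eqP; rewrite -subr_eq0; apply/eqP.
(* The two sides differ by - v sin(y) times the equation of the tilt. *)
rewrite -[RHS](mulr0 (- (speed v * sin y))) -dE.
case: v; rewrite /speed /velocity /= ?expr1 ?expr0.
  by rewrite EN1 E1 !cosD !sinD cosN sinN mulrN1z mulr1z; ring.
by rewrite EN1 E1 !cosD !sinD cosN sinN mulrN1z mulr1z; ring.
Qed.

Lemma bounded_rt_eigenfun q c : bounded_function (rt_eigenfun q c).
Proof.
exists (1 + `|tilt q|) => -[x v] /=; rewrite (le_trans (ler_normB _ _))//.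
rewrite lerD ?cos_max// normrM normrM norm_speed mulr1.
by rewrite ler_piMr// sin_max.
Qed.

End eigenfunctions.

(** * The Markov property as an identity between expectations *)

(** The values of a probability kernel, as an object that can carry the
    structure of a probability measure. *)
Definition kernel_at {R : realType} (k : R.-pker state ~> state) (x : state) :
  set state -> \bar R := k x.

HB.instance Definition _ (R : realType) (k : R.-pker state ~> state) x :=
  Measure.copy (kernel_at k x) (k x).

Lemma kernel_at_setT (R : realType) (k : R.-pker state ~> state) x :
  kernel_at k x setT = 1%E.
Proof. exact: (@prob_kernel _ _ _ _ _ k). Qed.

HB.instance Definition _ (R : realType) (k : R.-pker state ~> state) x :=
  @Measure_isProbability.Build _ _ R (kernel_at k x) (kernel_at_setT k x).

Section markov_integral.
Context {R : realType} d (T : measurableType d) (P : probability T R).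

(** The hypothesis says that the law of Z is the composition of the law of X,
    seen as a kernel from the one-point space, with k; an integral against a
    composition of kernels is an iterated integral. *)
Lemma ge0_integral_mixture (X Z : {RV P >-> state}) (k : R.-pker state ~> state) :
  (forall B : set state, P (Z @^-1` B) = \int[P]_w k (X w) B)%E ->
  forall f : state -> \bar R, (forall x, 0 <= f x)%E ->
  (\int[P]_w f (Z w) = \int[P]_w \int[k (X w)]_y f y)%E.
Proof.
move=> XZ f f0.
pose l := kprobability (@measurable_cst _ _ unit (pprobability state R) setT
  (distribution P X : pprobability state R)).
have mk U : measurable_fun [set: state] (k ^~ U) by [].
transitivity (\int[distribution P Z]_y f y)%E.
  by rewrite ge0_integral_distribution.
transitivity (\int[kcomp l (kernel.kernel_snd k) tt]_y f y)%E.
  apply: eq_measure_integral => /= U mU _.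
  rewrite /kcomp /= [LHS]XZ ge0_integral_distribution//.
rewrite integral_kcomp//.
transitivity (\int[distribution P X]_y \int[k y]_z f z)%E.
  exact: eq_integral.
by rewrite ge0_integral_distribution// => y; exact: integral_ge0.
Qed.

Lemma integrable_state (Q : probability state R) (f : state -> R) :
  bounded_function f -> Q.-integrable setT (EFin \o f).
Proof. by move=> [M fM]; exact: (integrable_bounded Q _ fM). Qed.

Lemma integrable_RV_state (X : {RV P >-> state}) (f : state -> R) :
  bounded_function f -> P.-integrable setT (EFin \o (fun w => f (X w))).
Proof.
move=> [M fM]; apply: (@integrable_bounded _ _ _ _ _ M) => [|w]; last exact: fM.
by apply: (measurableT_comp (f := f)).
Qed.

Lemma Rintegral_mixture (X Z : {RV P >-> state}) (k : R.-pker state ~> state) :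
  (forall B : set state, P (Z @^-1` B) = \int[P]_w k (X w) B)%E ->
  forall f : state -> R, bounded_function f ->
  \int[P]_w f (Z w) = \int[P]_w \int[k (X w)]_y f y.
Proof.
move=> XZ f [M fM].
have bf : bounded_function f by exists M.
have M0 : 0 <= M by rewrite (le_trans _ (fM point)).
have bkf : bounded_function (fun x => \int[k x]_y f y).
  by exists M => x; exact: (le_norm_Rintegral_prob (kernel_at k x)).
(* [F] is nonnegative, and adding M shifts both sides by M. *)
pose F x := f x + M.
have F0 x : 0 <= F x.
  by have := fM x; rewrite ler_norml -lerBlDr sub0r => /andP[].
have bM : bounded_function (fun _ : state => M) by exists `|M|.
have iM (Q : probability state R) : \int[Q]_x F x = \int[Q]_x f x + M.
  rewrite RintegralD//; [|exact: integrable_state..].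
  by congr (_ + _); exact: Rintegral_prob_cst.
have iMP (X' : {RV P >-> state}) g : bounded_function g ->
    \int[P]_w (g (X' w) + M) = \int[P]_w g (X' w) + M.
  move=> bg; rewrite RintegralD//; last 2 first.
  - exact: integrable_RV_state.
  - exact: (@integrable_RV_state X' (fun=> M)).
  by congr (_ + _); exact: Rintegral_prob_cst.
apply: (addIr M); rewrite -iMP// -(iMP X (fun x => \int[k x]_y f y))//.
rewrite [LHS]/Rintegral (ge0_integral_mixture XZ (f := EFin \o F))//.
congr fine; apply: eq_integral => w _.
rewrite -(iM (kernel_at k (X w))).
rewrite fineK//; apply: (integrable_fin_num measurableT).
apply: (integrable_state (kernel_at k (X w))).
by exists (M + M) => x; rewrite (le_trans (ler_normD _ _))// lerD// ger0_norm.
Qed.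

End markov_integral.

(** * Expectations of eigenfunctions *)

Section linear_ode.
Context {R : realType}.
Implicit Types (w : R -> R) (m : R).

(** From 1 - x <= exp(-x) one gets exp(x) <= 1 / (1 - x), and 1 / (1 - x) - 1 -
    x = x^2 / (1 - x) <= x^2. *)
Lemma expR_sub1_le (x : R) : x <= 0 -> `|expR x - 1 - x| <= x ^+ 2.
Proof.
move=> x0; rewrite ger0_norm; last first.
  by rewrite -addrA -opprD subr_ge0 expR_ge1Dx.
have x1 : 0 < 1 - x by rewrite subr_gt0 (le_lt_trans x0).
have h : expR x <= (1 - x)^-1.
  by rewrite -[x in expR x]opprK expRN lef_pV2 ?posrE ?expR_gt0// expR_ge1Dx.
apply: (@le_trans _ _ ((1 - x)^-1 - 1 - x)); first by rewrite !lerD2r.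
rewrite (_ : _ - x = x ^+ 2 / (1 - x)); last by field; rewrite gt_eqF.
by rewrite ler_pdivrMr// ler_peMr ?sqr_ge0// lerBrDr gerDl.
Qed.

Lemma near_at_right0 (Q : R -> Prop) : (\forall h \near 0^'+, Q h) ->
  exists2 r, 0 < r & forall h, 0 < h -> h < r -> Q h.
Proof.
move=> [r /= r0 rQ]; exists r => // h h0 hr; apply: rQ => //=.
by rewrite sub0r normrN gtr0_norm.
Qed.

(** Euler's method: w satisfies w' = m w up to an error that is uniform in
    time. In n steps of length h = t / n, each with an error at most (e / t) h,
    the errors add up to at most e, because 0 <= 1 + h m <= 1. *)
Lemma approx_linear_ode_eq0 w m : m <= 0 -> w 0 = 0 ->
  (forall e, 0 < e -> \forall h \near 0^'+, forall t, 0 <= t ->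
    `|w (t + h) - (1 + h * m) * w t| <= e * h) ->
  forall t, 0 <= t -> w t = 0.
Proof.
move=> m0 w0 wh t; rewrite le_eqVlt => /predU1P[<-//|t0].
apply/eqP; rewrite -normr_le0; apply/ler_addgt0Pl => e e0; rewrite addr0.
have et : 0 < e / t by rewrite divr_gt0.
have hm : \forall h \near (0:R)^'+, 0 <= 1 + h * m.
  have m1 : 0 < (1 - m)^-1 by rewrite invr_gt0 subr_gt0 (le_lt_trans m0).
  near=> h.
  have h0 : 0 < h by near: h; exact: nbhs_right_gt.
  have : h <= (1 - m)^-1 by near: h; exact: nbhs_right_le.
  by rewrite -[leRHS]mul1r ler_pdivlMr; [nra|lra].
have [r r0 rP] := near_at_right0 (filterI hm (wh _ et)).
have [n nr] : exists n : nat, t / r < n.+1%:R.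
  near \oo => n; exists n; apply: (@lt_trans _ _ n%:R); last by rewrite ltr_nat.
  by near: n; exact: nbhs_infty_gtr.
pose h := t / n.+1%:R.
have h0 : 0 < h by rewrite divr_gt0.
have hr : h < r by rewrite /h ltr_pdivrMr// mulrC -ltr_pdivrMr.
have [hm0 hw] := rP _ h0 hr.
have hm1 : 1 + h * m <= 1 by rewrite gerDl pmulr_rle0.
have step k : `|w (k%:R * h)| <= e / t * h * k%:R.
  elim: k => [|k IH]; first by rewrite mul0r w0 normr0 mulr0.
  rewrite -natr1 mulrDl mul1r mulrDr mulr1.
  rewrite -[w _](subrK ((1 + h * m) * w (k%:R * h))) addrC.
  rewrite (le_trans (ler_normD _ _))// lerD//; last first.
    by apply: hw; rewrite mulr_ge0// ltW.
  by rewrite normrM (ger0_norm hm0) (le_trans _ IH)// ler_piMl.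
have := step n.+1.
rewrite (_ : n.+1%:R * h = t); last by rewrite /h mulrC divfK.
by rewrite (_ : e / t * h * _ = e)// /h -mulrA divfK// divfK// gt_eqF.
Unshelve. all: by end_near. Qed.

End linear_ode.

Section process.
Context {R : realType} d (T : measurableType d) (P : probability T R).
Variables (Y : R -> {RV P >-> state}) (p : R -> R.-pker state ~> state).
Variable L : (state -> R) -> state -> R.
Hypothesis hgen : has_generator p L.
Hypothesis hmarkov : markov_property Y p.
Implicit Types (f : state -> R).

Lemma expectation_markov f s t : 0 <= s -> 0 <= t -> bounded_function f ->
  \int[P]_w f (Y (s + t) w) = \int[P]_w \int[p t (Y s w)]_y f y.
Proof.
move=> s0 t0 bf; apply: Rintegral_mixture => // B.
(* The Markov property for the sure event, which belongs to the filtration. *)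
rewrite -(hmarkov s0 t0 (A := setT)) ?setTI//.
have [S0 SC _] := @smallest_sigma_algebra _ setT
  [set A | exists (u : R) (B : set state),
    0 <= u <= s /\ A = (Y u : T -> state) @^-1` B].
by rewrite -(setD0 setT); exact: SC.
Qed.

Lemma bounded_kernel_integral f t : bounded_function f ->
  bounded_function (fun x => \int[p t x]_y f y).
Proof.
by move=> [M fM]; exists M => x; exact: (le_norm_Rintegral_prob (kernel_at (p t) x)).
Qed.

(** The convergence to the generator is uniform in the state, so it can be
    integrated against the law of Y_t with an error that does not depend on
    t. *)
Lemma expectation_step f : bounded_function f -> bounded_function (L f) ->
  forall e, 0 < e -> \forall h \near 0^'+, forall t, 0 <= t ->
  `|\int[P]_w f (Y (t + h) w) - \int[P]_w f (Y t w) - h * \int[P]_w L f (Y t w)|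
    <= e * h.
Proof.
move=> bf bLf e e0; have := hgen bf e0; apply: filter_app; near=> h.
have h0 : 0 < h by near: h; exact: nbhs_right_gt.
move=> hL t t0; rewrite (expectation_markov t0 (ltW h0) bf).
have bk := bounded_kernel_integral h bf.
have i1 := integrable_RV_state (Y t) bk.
have i2 := integrable_RV_state (Y t) bf.
have i3 := integrable_RV_state (Y t) bLf.
rewrite -RintegralB// -RintegralZl// -RintegralB//; last 2 first.
- exact: integrable_sub.
- exact: integrable_scale.
apply: le_norm_Rintegral_prob => [|w].
  by apply: (measurableT_comp
    (f := fun x => \int[p h x]_y f y - f x - h * L f x)).
rewrite (_ : _ - _ - _ = h * (h^-1 * (\int[p h (Y t w)]_y f y - f (Y t w)) -
    L f (Y t w))); last by field; rewrite gt_eqF.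
by rewrite normrM (gtr0_norm h0) mulrC ler_wpM2r// ltW.
Unshelve. all: by end_near. Qed.

(** The difference of the two sides vanishes at time 0 and satisfies w' = m w
    up to an error uniform in time: the expectation by [expectation_step], the
    exponential by [expR_sub1_le]. *)
Lemma expectation_eigenfun f (m : R) : m <= 0 -> bounded_function f ->
  (forall x, L f x = m * f x) -> forall t, 0 <= t ->
  \int[P]_w f (Y t w) = expR (m * t) * \int[P]_w f (Y 0 w).
Proof.
move=> m0 bf Lf t t0.
set u0 := \int[P]_w f (Y 0 w).
pose w (s : R) := \int[P]_w f (Y s w) - expR (m * s) * u0.
have bLf : bounded_function (L f).
  have [M fM] := bf; exists (`|m| * M) => x.
  by rewrite Lf normrM ler_wpM2l.
apply/eqP; rewrite -subr_eq0; apply/eqP.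
apply: (@approx_linear_ode_eq0 _ w m) => //.
  by rewrite /w mulr0 expR0 mul1r subrr.
move=> e e0; have e2 : 0 < e / 2 by rewrite divr_gt0.
have := expectation_step bf bLf e2; apply: filter_app; near=> h.
have h0 : 0 < h by near: h; exact: nbhs_right_gt.
have hh : h <= e / 2 / (m ^+ 2 * `|u0| + 1).
  near: h; apply: nbhs_right_le; rewrite divr_gt0// ltr_wpDl// mulr_ge0//.
  exact: sqr_ge0.
move=> hs s s0; have {hs} := hs s s0.
have -> : \int[P]_w L f (Y s w) = m * \int[P]_w f (Y s w).
  rewrite -RintegralZl//; last exact: integrable_RV_state.
  by apply: eq_Rintegral => x _; rewrite Lf.
move=> h1; rewrite /w.
set a := \int[P]_w f (Y (s + h) w) in h1 *; set b := \int[P]_w f (Y s w) in h1 *.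
rewrite mulrDr expRD.
set E := expR (m * s); set G := expR (m * h).
have E1 : E <= 1 by rewrite -expR0 ler_expR mulr_le0_ge0.
have G1 : `|G - 1 - m * h| <= (m * h) ^+ 2.
  by apply: expR_sub1_le; rewrite mulr_le0_ge0// ltW.
rewrite (_ : _ - _ = (a - b - h * (m * b)) - E * u0 * (G - 1 - m * h)); last by ring.
rewrite (le_trans (ler_normB _ _))// (_ : e * h = e / 2 * h + e / 2 * h); last by field.
rewrite lerD// 2!normrM (ger0_norm (expR_ge0 _)).
rewrite (@le_trans _ _ (`|u0| * (m * h) ^+ 2))//.
  by rewrite ler_pM ?mulr_ge0 ?expR_ge0// ler_piMl.
rewrite (_ : _ * _ = h * (m ^+ 2 * `|u0|) * h); last by ring.
rewrite ler_wpM2r ?(ltW h0)//.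
have c0 : 0 <= m ^+ 2 * `|u0| by rewrite mulr_ge0 ?sqr_ge0.
move: hh; rewrite ler_pdivlMr ?ltr_wpDl// => /(le_trans _); apply.
by rewrite ler_wpM2l ?(ltW h0)// lerDl.
Unshelve. all: by end_near. Qed.

(** By [expectation_step] the expectation is Lipschitz at small distances,
    hence it extends continuously to the real line, constant at negative
    times. *)
Lemma measurable_expectation f : bounded_function f -> bounded_function (L f) ->
  measurable_fun (`[0, +oo[%classic : set R) (fun t => \int[P]_w f (Y t w)).
Proof.
move=> bf bLf.
have [M LM] := bLf.
have [r r0 rP] := near_at_right0 (expectation_step bf bLf ltr01).
pose u t := \int[P]_w f (Y t w).
have ur (t h : R) : 0 <= t -> 0 < h -> h < r ->
    `|u (t + h) - u t| <= (`|M| + 1) * h.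
  move=> t0 h0 hr; have := rP h h0 hr t t0; rewrite mul1r -/(u t) -/(u (t + h)).
  set l := Rintegral _ _ _ => H.
  have lM : `|l| <= `|M|.
    apply: le_norm_Rintegral_prob => [|w].
      by apply: (measurableT_comp (f := L f)).
    by rewrite (le_trans (LM _))// ler_norm.
  rewrite -[_ - u t](subrK (h * l)) (le_trans (ler_normD _ _))//.
  rewrite mulrDl mul1r addrC lerD// normrM (gtr0_norm h0) mulrC.
  by rewrite ler_wpM2r// ltW.
pose v (t : R) := u (Num.max t 0).
have cv : continuous v.
  move=> t; apply/cvgrPdist_le => e e0.
  have M1 : 0 < `|M| + 1 by rewrite ltr_wpDl.
  near=> s.
  have sr : `|t - s| < r by near: s; exact: cvgr_dist_lt.
  have se : `|t - s| <= e / (`|M| + 1).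
    by near: s; apply: cvgr_dist_le => //; rewrite divr_gt0.
  have key (a b : R) : a <= b -> b - a < r -> b - a <= e / (`|M| + 1) ->
      `|v b - v a| <= e.
    move=> ab bar bae; rewrite /v.
    have : Num.max b 0 - Num.max a 0 <= b - a.
      by rewrite !maxEle; case: ifPn; case: ifPn; lra.
    have : Num.max a 0 <= Num.max b 0.
      by rewrite !maxEle; case: ifPn; case: ifPn; lra.
    rewrite le_eqVlt => /predU1P[-> _|lt h].
      by rewrite subrr normr0 ltW.
    have := ur (Num.max a 0) (Num.max b 0 - Num.max a 0).
    rewrite [Num.max a 0 + _]addrC subrK le_max lexx orbT subr_gt0 => /(_ isT lt).
    rewrite (le_lt_trans h bar) => /(_ isT) /le_trans; apply.
    by rewrite -ler_pdivlMl// mulrC (le_trans h).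
  have [st|ts] := leP s t.
    by apply: key => //; rewrite -(ger0_norm (_ : 0 <= t - s)) ?subr_ge0.
  by rewrite distrC; apply: key; rewrite ?(ltW ts)//;
    rewrite -(ger0_norm (_ : 0 <= s - t)) ?subr_ge0 ?(ltW ts)// distrC.
have mv : measurable_fun (`[0, +oo[%classic : set R) v.
  by apply: measurable_funTS; exact: continuous_measurable_fun.
apply: eq_measurable_fun mv => t; rewrite inE/= in_itv/= andbT => t0.
by rewrite /v max_l.
Unshelve. all: by end_near. Qed.

End process.

(** * The characteristic function of the position *)

Section run_and_tumble_char.
Context {R : realType} d (T : measurableType d) (P : probability T R).
Variables (lambda kappa gamma : R).
Hypotheses (hlambda : 0 <= lambda) (hkappa : 0 <= kappa) (hgamma : 0 < gamma).
Variable Y : R -> {RV P >-> state}.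
Hypothesis hY : run_and_tumble lambda kappa gamma Y.
Hypothesis hY0 : {ae P, forall w, position (Y 0 w) = 0}.

Local Notation L := (rt_generator lambda kappa gamma).
Local Notation tilt := (tilt lambda gamma).
Local Notation rt_eigenvalue := (rt_eigenvalue lambda kappa gamma).
Local Notation eigenfun := (rt_eigenfun lambda gamma).

Lemma bounded_rt_generator f : bounded_function f -> bounded_function (L f).
Proof.
move=> [M fM].
exists (lambda * (M + M) + kappa * (M + M + 2 * M) + gamma * (M + M)).
move=> [x v]; rewrite /rt_generator.
have B2 y z : `|f y - f z| <= M + M by rewrite (le_trans (ler_normB _ _))// lerD.
rewrite (le_trans (ler_normD _ _))// lerD//; last first.
  by rewrite normrM (gtr0_norm hgamma) ler_wpM2l// ltW.
rewrite (le_trans (ler_normD _ _))// lerD//.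
  by rewrite normrM (ger0_norm hlambda) ler_wpM2l.
rewrite normrM (ger0_norm hkappa) ler_wpM2l// (le_trans (ler_normB _ _))//.
rewrite lerD// ?(le_trans (ler_normD _ _)) ?lerD//.
by rewrite normrM ger0_norm// ler_wpM2l.
Qed.

Definition cos_state (q c : R) (s : state) : R :=
  cos (q * (position s)%:~R + c).

Lemma bounded_cos_state q c : bounded_function (cos_state q c).
Proof. by exists 1 => s; exact: cos_max. Qed.

(** At time 0 the position vanishes, and the eigenfunction is cos c - d v sin
    c. *)
Lemma expectation_eigenfun0 q c :
  `|\int[P]_w eigenfun q c (Y 0 w) - cos c| <= `|tilt q|.
Proof.
pose h (s : state) := cos c - tilt q * speed s.2 * sin c.
have -> : \int[P]_w eigenfun q c (Y 0 w) = \int[P]_w h (Y 0 w).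
  congr fine; apply: ae_eq_integral => //.
  - by apply/measurable_EFinP; apply: (measurableT_comp (f := eigenfun q c)).
  - by apply/measurable_EFinP; apply: (measurableT_comp (f := h)).
  - have := hY0; apply: filterS => w /=; rewrite /h /position.
    by case: (Y 0 w) => x v /= -> _; rewrite mulr0 add0r.
have bh : bounded_function h.
  exists (1 + `|tilt q|) => s; rewrite (le_trans (ler_normB _ _))//.
  rewrite lerD ?cos_max// normrM normrM norm_speed mulr1.
  by rewrite ler_piMr// sin_max.
rewrite -[X in _ - X](Rintegral_prob_cst P) -RintegralB//; last 2 first.
- exact: (integrable_RV_state (Y 0) bh).
- by apply: (@integrable_bounded _ _ _ P _ `|cos c|).
apply: le_norm_Rintegral_prob => [|w].
  by apply: (measurableT_comp (f := fun s => h s - cos c)).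
rewrite /h addrC addrA addNr add0r normrN normrM normrM norm_speed mulr1.
by rewrite ler_piMr// sin_max.
Qed.

(** The velocity term of the eigenfunction is bounded by the tilt; dropping it
    costs |d| at time 0 and |d| at time t. *)
Lemma char_estimate q c t : `|lambda * sin q| <= gamma -> 0 <= t ->
  `|\int[P]_w cos_state q c (Y t w) - cos c * expR (rt_eigenvalue q * t)|
    <= 2 * `|tilt q|.
Proof.
move=> qg t0; have [_ [p [_ hgen hmk]]] := hY.
have m0 := rt_eigenvalue_le0 hlambda hkappa hgamma q.
have be : bounded_function (eigenfun q c) := bounded_rt_eigenfun _ _ q c.
have E := expectation_eigenfun hgen hmk m0 be
  (fun s => rt_generator_eigenfun kappa hgamma c s qg) t0.
pose k (s : state) := speed s.2 * sin (q * (position s)%:~R + c) : R.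
have bk1 s : `|k s| <= 1 by rewrite normrM norm_speed mul1r sin_max.
have bk : bounded_function k by exists 1.
have : \int[P]_w eigenfun q c (Y t w) =
    \int[P]_w cos_state q c (Y t w) - tilt q * \int[P]_w k (Y t w).
  rewrite -RintegralZl//; last exact: (integrable_RV_state (Y t) bk).
  rewrite -RintegralB//; last 2 first.
  - exact: (integrable_RV_state (Y t) (bounded_cos_state q c)).
  - by apply: integrable_scale => //; exact: (integrable_RV_state (Y t) bk).
  by apply: eq_Rintegral => w _; case: (Y t w) => x v; rewrite /k /= mulrA.
rewrite E; set C := \int[P]_w cos_state _ _ _; set K := \int[P]_w k _.
move/eqP; rewrite eq_sym subr_eq => /eqP ->.
have K1 : `|K| <= 1.
  by apply: le_norm_Rintegral_prob => //; apply: (measurableT_comp (f := k)).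
have := expectation_eigenfun0 q c; set U := Rintegral _ _ _ => U0.
set e := expR _; have e1 : e <= 1 by rewrite -expR0 ler_expR mulr_le0_ge0.
rewrite (_ : _ - _ = e * (U - cos c) + tilt q * K); last by ring.
rewrite (le_trans (ler_normD _ _))// (_ : 2 * _ = `|tilt q| + `|tilt q|); last by ring.
rewrite lerD// normrM; last by rewrite ler_piMr.
by rewrite (ger0_norm (expR_ge0 _)) (le_trans _ U0)// ler_piMl.
Qed.

Lemma measurable_char q c :
  measurable_fun (`[0, +oo[%classic : set R)
    (fun t => \int[P]_w cos_state q c (Y t w)).
Proof.
have [_ [p [_ hgen hmk]]] := hY.
apply: (measurable_expectation hgen hmk (bounded_cos_state q c)).
exact/bounded_rt_generator/bounded_cos_state.
Qed.

End run_and_tumble_char.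

(** * The diffusive scaling of the eigenvalue *)

Section scaling_limits.
Context {R : realType}.
Variables (lambda kappa gamma : R).
Hypotheses (hlambda : 0 <= lambda) (hkappa : 0 <= kappa) (hgamma : 0 < gamma).
Local Notation tilt := (tilt lambda gamma).
Local Notation rt_eigenvalue := (rt_eigenvalue lambda kappa gamma).
Local Notation sigma2 := (diffusivity lambda kappa gamma).

Lemma cvg_mul_dnbhs0 (a : R) : a != 0 -> a * x @[x --> 0^'] --> (0 : R)^'.
Proof.
move=> a0 A [r /= r0 rA]; have a1 : 0 < `|a| by rewrite normr_gt0.
exists (r / `|a|) => /=; first by rewrite divr_gt0.
move=> x; rewrite /ball/= sub0r normrN ltr_pdivlMr// => xr x0.
apply: rA; last by rewrite mulf_neq0.
by rewrite /ball/= sub0r normrN normrM mulrC.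
Qed.

Lemma cvg_sqr (F : set_system R) {FF : Filter F} (f : R -> R) (a : R) :
  f x @[x --> F] --> a -> f x ^+ 2 @[x --> F] --> a ^+ 2.
Proof. by move=> fa; rewrite expr2; exact: (cvgM fa fa). Qed.

(** The derivative of the sine at 0. *)
Lemma cvg_sinc : sin x / x @[x --> 0^'] --> (1 : R).
Proof.
have [dsin Dsin] := is_derive_sin (0 : R).
rewrite -[X in _ --> X](_ : 'D_1 sin (0 : R) = 1); last by rewrite Dsin cos0.
suff -> : (fun x : R => sin x / x) =
  (fun h => h^-1 *: ((sin \o shift 0) (h *: 1) - sin 0)) by exact: dsin.
by apply/funext => x; rewrite /= sin0 subr0 addr0 [x *: 1]mulr1 mulrC.
Qed.

Lemma cvg_sinc_sqr : (sin x / x) ^+ 2 @[x --> 0^'] --> (1 : R).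
Proof. by rewrite -[X in _ --> X](expr1n _ 2); apply: cvg_sqr; exact: cvg_sinc. Qed.

(** The half-angle formula 1 - cos x = 2 sin(x / 2)^2 reduces this to
    [cvg_sinc]. *)
Lemma cvg_cosc : (1 - cos x) / x ^+ 2 @[x --> 0^'] --> (2^-1 : R).
Proof.
have h2 : (2^-1 : R) != 0 by rewrite invr_eq0.
rewrite -[X in _ --> X]mulr1.
have -> : (fun x : R => (1 - cos x) / x ^+ 2) =
    (fun x => 2^-1 * (sin (2^-1 * x) / (2^-1 * x)) ^+ 2).
  apply/funext => x; have [->|x0] := eqVneq x 0.
    by rewrite cos0 subrr mul0r mulr0 invr0 mulr0 expr0n/= mulr0.
  have -> : cos x = 1 - 2 * sin (2^-1 * x) ^+ 2.
    rewrite -{1}(_ : (2^-1 * x) *+ 2 = x); last by rewrite -mulr_natr; field.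
    rewrite cos_mulr2n cos2sin2; ring.
  by field.
by apply: cvgMr; apply: (cvg_comp _ _ (cvg_mul_dnbhs0 h2) cvg_sinc_sqr).
Qed.

Lemma cvg_sin0 : sin x @[x --> 0^'] --> (0 : R).
Proof.
rewrite -[X in _ --> X]sin0; apply: cvg_within_filter; exact: continuous_sin.
Qed.

Lemma cvg_tilt : tilt x @[x --> 0^'] --> (0 : R).
Proof.
apply/norm_cvg0P; apply: (@squeeze_cvgr _ _ _ _ (cst 0)
  (fun x => lambda / gamma * `|sin x|)).
- by near=> x; rewrite normr_ge0/= norm_tilt_le.
- exact: cvg_cst.
- rewrite -[X in _ --> X](mulr0 (lambda / gamma)); apply: cvgMr.
  by apply/norm_cvg0P; exact: cvg_sin0.
Unshelve. all: by end_near. Qed.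

Lemma near_sin_le : \forall x \near 0^', `|lambda * sin x| <= gamma.
Proof.
have /cvgr0Pnorm_le/(_ _ hgamma) : lambda * sin x @[x --> 0^'] --> (0 : R).
  by rewrite -[X in _ --> X](mulr0 lambda); apply: cvgMr; exact: cvg_sin0.
by [].
Qed.

Lemma cvg_rt_eigenvalue : rt_eigenvalue x / x ^+ 2 @[x --> 0^'] --> - (sigma2 / 2).
Proof.
pose D (x : R) := gamma + Num.sqrt (gamma ^+ 2 - (lambda * sin x) ^+ 2).
have -> : (fun x : R => rt_eigenvalue x / x ^+ 2) =
  (fun x => - ((lambda + 2 * kappa) * ((1 - cos x) / x ^+ 2)) -
     lambda ^+ 2 * (sin x / x) ^+ 2 / D x).
  apply/funext => x; have [->|x0] := eqVneq x 0.
    by rewrite !(expr0n, invr0, mulr0, mul0r, subr0, oppr0).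
  by rewrite /rt_eigenvalue /tilt -/(D x); field; rewrite x0 gt_eqF// tilt_denom_gt0.
have -> : - (sigma2 / 2) = - ((lambda + 2 * kappa) * 2^-1) -
    lambda ^+ 2 * 1 / (gamma + gamma).
  by rewrite /diffusivity; field; rewrite !gt_eqF// addr_gt0.
apply: cvgB; first by apply: cvgN; apply: cvgMr; exact: cvg_cosc.
apply: cvgM; first by apply: cvgMr; exact: cvg_sinc_sqr.
apply: cvgV; first by rewrite gt_eqF// addr_gt0.
apply: cvgD; first exact: cvg_cst.
rewrite -[X in _ --> X](_ : Num.sqrt (gamma ^+ 2 - (lambda * 0) ^+ 2) = gamma); last first.
  by rewrite mulr0 expr0n subr0 sqrtr_sqr gtr0_norm.
apply: continuous_cvg; first exact: sqrt_continuous.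
apply: cvgB; first exact: cvg_cst.
by apply: cvg_sqr; apply: cvgMr; exact: cvg_sin0.
Qed.

Lemma cvg_rt_eigenvalue_scaled (q : R) :
  rt_eigenvalue (x * q) / x ^+ 2 @[x --> 0^'] --> - (q ^+ 2 / 2 * sigma2).
Proof.
have [->|q0] := eqVneq q 0.
  rewrite expr0n/= !mul0r oppr0; under eq_fun do rewrite mulr0 /rt_eigenvalue cos0 sin0
    subrr !mulr0 mul0r subr0 oppr0 mul0r.
  exact: cvg_cst.
rewrite (_ : - _ = q ^+ 2 * (- (sigma2 / 2))); last by ring.
have -> : (fun x => rt_eigenvalue (x * q) / x ^+ 2) =
    (fun x => q ^+ 2 * (rt_eigenvalue (q * x) / (q * x) ^+ 2)).
  apply/funext => x; rewrite [x * q]mulrC; set m := rt_eigenvalue _.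
  have [->|x0] := eqVneq x 0; last by field; rewrite q0 x0.
  by rewrite mulr0 expr0n/= invr0 !mulr0.
by apply: cvgMr; apply: (cvg_comp _ _ (cvg_mul_dnbhs0 q0) cvg_rt_eigenvalue).
Qed.

Lemma cvg_tilt_scaled (q : R) : tilt (x * q) @[x --> 0^'] --> (0 : R).
Proof.
have [->|q0] := eqVneq q 0.
  by under eq_fun do rewrite mulr0 /tilt sin0 mulr0 mul0r; exact: cvg_cst.
under eq_fun do rewrite mulrC.
by apply: (cvg_comp _ _ (cvg_mul_dnbhs0 q0) cvg_tilt).
Qed.

Lemma near_sin_le_scaled (q : R) :
  \forall x \near 0^', `|lambda * sin (x * q)| <= gamma.
Proof.
have [->|q0] := eqVneq q 0.
  by near=> x; rewrite mulr0 sin0 mulr0 normr0 ltW.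
have h : \forall x \near 0^', `|lambda * sin (q * x)| <= gamma.
  exact: (cvg_mul_dnbhs0 q0 near_sin_le).
by near=> x; rewrite [x * q]mulrC; near: x.
Unshelve. all: by end_near. Qed.

End scaling_limits.

(** * Laplace transforms *)

Section laplace.
Context {R : realType}.
Notation mu := (@lebesgue_measure R).
Local Notation half_line := (`[0, +oo[%classic : set R).

Lemma integral_expR_decay (a : R) : 0 < a ->
  (\int[mu]_(t in half_line) (expR (- (a * t)))%:E = (a^-1)%:E)%E.
Proof.
move=> a0.
have dF (x : R) : is_derive x 1 (fun t : R => - a^-1 * expR (- (a * t)))
    (expR (- (a * x))).
  have d1 : is_derive x 1 (fun t : R => - (a * t)) (- a).
    have := is_derive_affine (- a) 0 x.
    by congr (is_derive _ _ _ _); apply/funext => y; rewrite addr0 mulNr.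
  have d2 : is_derive x 1 (fun t : R => expR (- (a * t))) (expR (- (a * x)) * - a).
    exact: (@is_derive1_comp _ expR _ _ _ _ (is_derive_expR _) d1).
  rewrite [X in is_derive _ _ _ X](_ : _ = - a^-1 *: (expR (- (a * x)) * - a)).
    exact: (is_deriveZ (- a^-1) d2).
  by rewrite /GRing.scale/=; field; rewrite gt_eqF.
have cF : continuous (fun t : R => - a^-1 * expR (- (a * t))).
  move=> x; apply/differentiable_continuous/derivable1_diffP.
  by have [] := dF x.
have ce : continuous (fun t : R => expR (- (a * t))).
  move=> x; apply: continuous_comp; last exact: continuous_expR.
  by apply: cvgN; exact: mulrl_continuous.
rewrite (@ge0_continuous_FTC2y _ _ (fun t => - a^-1 * expR (- (a * t))) _ 0) //.
- by rewrite mulr0 oppr0 expR0 mulr1 EFinN sub0e oppeK.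
- by apply: continuous_subspaceT.
- rewrite -(mulr0 (- a^-1)); apply: cvgMr.
  apply: (@cvg_comp _ _ _ (fun x : R => a * x) (fun x : R => expR (- x)) _
    (pinfty_nbhs R)); last exact: cvgr_expR.
  by apply: gt0_cvgMry => //; exact: cvg_id.
- by apply: cvg_at_right_filter; exact: cF.
- by move=> x _; rewrite derive1E; have [_ ->] := dF x.
Qed.

Lemma integrable_expR_decay (a : R) : 0 < a ->
  mu.-integrable half_line (EFin \o (fun t => expR (- (a * t)))).
Proof.
move=> a0; apply/integrableP; split.
  apply/measurable_EFinP; apply: measurable_funTS.
  apply: continuous_measurable_fun => x.
  apply: continuous_comp; last exact: continuous_expR.
  by apply: cvgN; exact: mulrl_continuous.
under eq_integral do rewrite /= ger0_norm ?expR_ge0//.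
by rewrite integral_expR_decay// ltry.
Qed.

Lemma integrable_mul_decay (u : R -> R) (M a : R) : 0 < a ->
  measurable_fun half_line u -> (forall t, 0 <= t -> `|u t| <= M) ->
  mu.-integrable half_line (EFin \o (fun t => u t * expR (- (a * t)))).
Proof.
move=> a0 mf uM; have ia := integrable_expR_decay a0.
apply: (@le_integrable _ _ R mu half_line _ _
  (EFin \o (fun t => M * expR (- (a * t))))) => //.
- apply/measurable_EFinP; apply: measurable_funM => //.
  by have /measurable_EFinP := measurable_int _ ia.
- move=> t /=; rewrite in_itv/= andbT => t0.
  by rewrite lee_fin !normrM ler_wpM2r// (le_trans (uM _ t0))// ler_norm.
- exact: integrable_scale.
Qed.

(** The Laplace transform of exp(m t) is 1 / (z - m), and that of the constant
    B is B / z. *)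
Lemma laplace_estimate (u : R -> R) (A B m z : R) : 0 < z -> m <= 0 ->
  measurable_fun half_line u ->
  (forall t, 0 <= t -> `|u t - A * expR (m * t)| <= B) ->
  `|\int[mu]_(t in half_line) (u t * expR (- (z * t))) - A / (z - m)| <= B / z.
Proof.
move=> z0 m0 mf uB.
have zm : 0 < z - m by rewrite subr_gt0 (le_lt_trans m0).
have mexp (a : R) : measurable_fun half_line (fun t => A * expR (a * t)).
  apply: measurable_funTS; apply: measurable_funM => //.
  by apply: measurableT_comp => //; exact: measurable_funM.
have Am t : 0 <= t -> `|A * expR (m * t)| <= `|A|.
  move=> t0; rewrite normrM ler_piMr// ger0_norm ?expR_ge0//.
  by rewrite -expR0 ler_expR mulr_le0_ge0.
have i1 := integrable_mul_decay z0 (mexp m) Am.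
have i2 : mu.-integrable half_line (EFin \o (fun t => u t * expR (- (z * t)))).
  apply: (@integrable_mul_decay _ (`|A| + B)) => // t t0.
  rewrite -[u t](subrK (A * expR (m * t))) addrC (le_trans (ler_normD _ _))//.
  by rewrite lerD ?Am ?uB.
have -> : A / (z - m) =
    \int[mu]_(t in half_line) (A * expR (m * t) * expR (- (z * t))).
  transitivity (\int[mu]_(t in half_line) (A * expR (- ((z - m) * t)))).
    rewrite RintegralZl//; last exact: integrable_expR_decay.
    by rewrite /Rintegral integral_expR_decay.
  apply: eq_Rintegral => t _; rewrite -mulrA -expRD.
  by congr (_ * expR _); ring.
rewrite -RintegralB//.
have i3 : mu.-integrable half_line
    (EFin \o (fun t => u t * expR (- (z * t)) -
      A * expR (m * t) * expR (- (z * t)))).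
  exact: integrable_sub.
apply: (le_trans (le_normr_Rintegral _ i3)) => //.
rewrite (_ : B / z = \int[mu]_(t in half_line) (B * expR (- (z * t)))); last first.
  rewrite RintegralZl//; last exact: integrable_expR_decay.
  by rewrite /Rintegral integral_expR_decay.
apply: le_Rintegral => //.
- exact: (integrable_norm i3).
- by apply: integrable_scale => //; exact: integrable_expR_decay.
- move=> t /=; rewrite in_itv/= andbT => t0.
  rewrite -mulrBl normrM (ger0_norm (expR_ge0 _)) ler_wpM2r ?expR_ge0//.
  exact: uB.
Qed.

End laplace.

(** * The diffusive limit *)

Section complex_limits.
Context {R : realType}.

Lemma cvg_complex (F : set_system R) {FF : Filter F} (a b : R -> R) (A B : R) :
  a x @[x --> F] --> A -> b x @[x --> F] --> B ->
  (Complex (a x) (b x) : R[i]^o) @[x --> F] --> (Complex A B : R[i]^o).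
Proof.
move=> aA bB; apply/cvgrPdist_le => -[e i].
(* A positive element of R[i] is real. *)
rewrite ltcE/= => /andP[/eqP -> e0].
have e2 : 0 < e / 2 by rewrite divr_gt0.
near=> x.
have ha : `|A - a x| <= e / 2 by near: x; move/cvgrPdist_le : aA; apply.
have hb : `|B - b x| <= e / 2 by near: x; move/cvgrPdist_le : bB; apply.
rewrite normc_def lecR /= -[leRHS]gtr0_norm// -sqrtr_sqr ler_wsqrtr//.
by move: ha hb; rewrite !ler_norml => /andP[? ?] /andP[? ?]; nra.
Unshelve. all: by end_near. Qed.

End complex_limits.

Section diffusive_limit.
Context {R : realType} d (T : measurableType d) (P : probability T R).
Variables (lambda kappa gamma : R).
Hypotheses (hlambda : 0 <= lambda) (hkappa : 0 <= kappa) (hgamma : 0 < gamma).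
Variable Y : R -> {RV P >-> state}.
Hypothesis hY : run_and_tumble lambda kappa gamma Y.
Hypothesis hY0 : {ae P, forall w, position (Y 0 w) = 0}.
Local Notation mu := (@lebesgue_measure R).
Local Notation tilt := (tilt lambda gamma).
Local Notation rt_eigenvalue := (rt_eigenvalue lambda kappa gamma).
Local Notation sigma2 := (diffusivity lambda kappa gamma).
Local Notation char q c t := (\int[P]_w cos_state q c (Y t w)).

Local Notation half_line := (`[0, +oo[%classic : set R).
Local Notation lap q c z :=
  (\int[mu]_(t in half_line) (char q c t * expR (- (z * t)))).

Lemma diffusivity_ge0 : 0 <= sigma2.
Proof.
by rewrite /diffusivity !addr_ge0 ?divr_ge0 ?sqr_ge0 ?mulr_ge0 ?(ltW hgamma).
Qed.

(** [char_estimate] with q replaced by x q: the error 2 |tilt (x q)| vanishes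
    with x, whatever the time. *)
Lemma cvg_char_scaled (q c t : R) : 0 < t ->
  char (x * q) c (x ^- 2 * t) @[x --> 0^'] -->
  cos c * expR (- (q ^+ 2 / 2 * sigma2) * t).
Proof.
move=> t0.
have c1 : cos c * expR (rt_eigenvalue (x * q) * (x ^- 2 * t)) @[x --> 0^'] -->
    cos c * expR (- (q ^+ 2 / 2 * sigma2) * t).
  apply: cvgMr; apply: continuous_cvg; first exact: continuous_expR.
  under eq_fun do rewrite mulrA.
  by apply: cvgMl; exact: cvg_rt_eigenvalue_scaled.
have c2 : 2 * `|tilt (x * q)| @[x --> 0^'] --> (0 : R).
  rewrite -[X in _ --> X](mulr0 2); apply: cvgMr.
  by apply/norm_cvg0P; exact: cvg_tilt_scaled.
apply/cvgrPdist_le => e e0; have e2 : 0 < e / 2 by rewrite divr_gt0.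
near=> x.
have xg : `|lambda * sin (x * q)| <= gamma by near: x; exact: near_sin_le_scaled.
have xt : 0 <= x ^- 2 * t by rewrite mulr_ge0 ?(ltW t0)// invr_ge0 sqr_ge0.
have := char_estimate hlambda hkappa hgamma hY hY0 c xg xt.
have : `|cos c * expR (- (q ^+ 2 / 2 * sigma2) * t) -
    cos c * expR (rt_eigenvalue (x * q) * (x ^- 2 * t))| <= e / 2.
  by near: x; move/cvgrPdist_le : c1; apply.
have : `|0 - 2 * `|tilt (x * q)| | <= e / 2.
  by near: x; move/cvgrPdist_le : c2; apply.
rewrite sub0r normrN (ger0_norm (mulr_ge0 (ler0n _ 2) (normr_ge0 _))).
set a := cos c * _; set b := cos c * _; set u := Rintegral _ _ _ => h1 h2 h3.
rewrite -(subrKA b) (le_trans (ler_normD _ _))// (splitr e) lerD//.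
by rewrite distrC (le_trans h3).
Unshelve. all: by end_near. Qed.

Lemma normal_law_char (v q : R) : 0 <= v ->
  \int[normal_law 0 v]_x cos (q * x) = expR (- (v * q ^+ 2 / 2)).
Proof.
move=> v0; rewrite /normal_law; have [->|vn0] := eqVneq v 0.
  rewrite /Rintegral integral_dirac//; last first.
    by apply/measurable_EFinP; exact: measurable_scale_cos.
  by rewrite diracT mul1e mulr0 cos0 !mul0r oppr0 expR0.
by rewrite normal_char_cos ?sqr_sqrtr// sqrtr_gt0 lt_neqAle eq_sym vn0.
Qed.

Lemma normal_law_char_sin (v q : R) : 0 <= v ->
  \int[normal_law 0 v]_x sin (q * x) = 0.
Proof.
move=> v0; rewrite /normal_law; have [_|vn0] := eqVneq v 0.
  rewrite /Rintegral integral_dirac//; last first.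
    by apply/measurable_EFinP; exact: measurable_scale_sin.
  by rewrite diracT mul1e mulr0 sin0.
by rewrite normal_char_sin// sqrtr_gt0 lt_neqAle eq_sym vn0.
Qed.

Lemma char_cosE (q x t : R) : char (x * q) 0 t =
  \int[P]_w cos (q * (x * (position (Y t w))%:~R)).
Proof.
by apply: eq_Rintegral => w _; rewrite /cos_state addr0; congr cos; ring.
Qed.

Lemma char_sinE (q x t : R) : char (x * q) (- (pi / 2)) t =
  \int[P]_w sin (q * (x * (position (Y t w))%:~R)).
Proof.
by apply: eq_Rintegral => w _; rewrite /cos_state cosBpihalf; congr sin; ring.
Qed.

(** Levy's theorem along an arbitrary sequence that tends to 0 from the
    right. *)
Lemma cvg_position_in_distribution t : 0 < t ->
  cvg_in_distribution P (0 : R)^'+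
    (fun eps w => eps * (position (Y (eps ^- 2 * t) w))%:~R)
    (normal_law 0 (sigma2 * t)).
Proof.
move=> t0 g cg bg; have [M gM] := bg.
have v0 : 0 <= sigma2 * t by rewrite mulr_ge0 ?diffusivity_ge0// ltW.
have mg : measurable_fun setT g by exact: continuous_measurable_fun.
pose nu := normal_law 0 (sigma2 * t).
pose W (x : R) (w : T) : R := x * (position (Y (x ^- 2 * t) w))%:~R.
have mW x : measurable_fun setT (W x).
  by apply: (measurableT_comp (f := fun s : state => x * (position s)%:~R)).
have -> : (\int[nu]_x (g x)%:E)%E = (\int[nu]_x g x)%:E.
  rewrite /Rintegral fineK//; apply: (integrable_fin_num measurableT).
  exact: (integrable_bounded nu mg gM).
have -> : (fun x => 'E_P[g \o W x])%E = (fun x => (\int[P]_w g (W x w))%:E).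
  apply/funext => x; rewrite unlock /Rintegral fineK//.
  apply: (integrable_fin_num measurableT).
  apply: (integrable_bounded P) => [|w]; last exact: gM.
  exact: measurableT_comp.
apply: cvg_EFin; first exact: nearW.
apply/cvg_at_rightP => u [u0 ucvg].
pose X n : {RV P >-> measurableTypeR R} := mfun_Sub
    (mem_set (mW (u n)) : (W (u n) : T -> measurableTypeR R) \in mfun).
pose P_ n : probability (measurableTypeR R) R := distribution P (X n).
have PE n (f : R -> R) : continuous f -> bounded_function f ->
    \int[P_ n]_x f x = \int[P]_w f (W (u n) w).
  move=> cf [N fN]; rewrite /Rintegral integral_distribution//.
    by apply/measurable_EFinP; exact: continuous_measurable_fun.
  apply: (integrable_bounded P) => [|w]; last exact: fN.
  by apply: measurableT_comp => //; exact: continuous_measurable_fun.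
rewrite (_ : (fun n => _) = (fun n => \int[P_ n]_x g x)); last first.
  by apply/funext => n; rewrite PE.
have uright (f : R -> R) (l : R) : f x @[x --> 0^'] --> l -> f (u n) @[n --> \oo] --> l.
  by move=> /cvgr_dnbhsP; apply; split => // n; rewrite gt_eqF.
have csin (q : R) : continuous (fun x : R => sin (q * x)).
  by have := @continuous_sin_affine _ q 0; under eq_fun do rewrite addr0.
have ccos (q : R) : continuous (fun x : R => cos (q * x)).
  by have := @continuous_cos_affine _ q 0; under eq_fun do rewrite addr0.
apply: (@levy_continuity _ P_ nu) => // q.
- rewrite (_ : (fun n => _) = (fun n => char (u n * q) 0 ((u n) ^- 2 * t))).
    rewrite normal_law_char//.
    have := uright _ _ (@cvg_char_scaled q 0 t t0); rewrite cos0 mul1r.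
    rewrite (_ : - (q ^+ 2 / 2 * sigma2) * t = - (sigma2 * t * q ^+ 2 / 2))//.
    by field.
  apply/funext => n; rewrite char_cosE PE//.
  by exists 1 => x; exact: cos_max.
- rewrite (_ : (fun n => _) =
      (fun n => char (u n * q) (- (pi / 2)) ((u n) ^- 2 * t))).
    rewrite normal_law_char_sin//.
    have := uright _ _ (@cvg_char_scaled q (- (pi / 2)) t t0).
    by rewrite cosN cos_pihalf mul0r.
  apply/funext => n; rewrite char_sinE PE//.
  by exists 1 => x; exact: sin_max.
Qed.

Lemma laplace_charE (q z : R) :
  laplace_char Y q z = Complex (lap q 0 z) (lap q (- (pi / 2)) z).
Proof.
rewrite /laplace_char /cintegral; congr Complex; apply: eq_Rintegral => t _.
  rewrite /char_position /cintegral /= mulr0 subr0; congr (_ * _).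
  by apply: eq_Rintegral => w _; rewrite /cos_state addr0.
rewrite /char_position /cintegral /= mulr0 add0r; congr (_ * _).
by apply: eq_Rintegral => w _; rewrite /cos_state cosBpihalf.
Qed.

Lemma scaled_laplace_charE (e q z : R) : e%:C%C * laplace_char Y q z =
  Complex (e * lap q 0 z) (e * lap q (- (pi / 2)) z).
Proof.
by rewrite laplace_charE; apply/eqP; rewrite eq_complex /= !mul0r subr0 addr0 !eqxx.
Qed.

(** [laplace_estimate] with x^2 z in place of z: after multiplication by x^2
    the error is 2 |tilt (x q)| / z. *)
Lemma cvg_laplace_scaled (q c z : R) : 0 < z ->
  x ^+ 2 * lap (x * q) c (x ^+ 2 * z) @[x --> 0^'] -->
  cos c / (z + q ^+ 2 / 2 * sigma2).
Proof.
move=> z0.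
have s0 : 0 <= q ^+ 2 / 2 * sigma2.
  by rewrite mulr_ge0 ?diffusivity_ge0// divr_ge0// sqr_ge0.
have c1 : cos c / (z - rt_eigenvalue (x * q) / x ^+ 2) @[x --> 0^'] -->
    cos c / (z + q ^+ 2 / 2 * sigma2).
  apply: cvgMr; apply: cvgV; first by rewrite gt_eqF// ltr_wpDr.
  rewrite -[X in z + X]opprK; apply: cvgB; first exact: cvg_cst.
  exact: cvg_rt_eigenvalue_scaled.
have c2 : 2 * `|tilt (x * q)| / z @[x --> 0^'] --> (0 : R).
  rewrite -[X in _ --> X](mul0r z^-1); apply: cvgMl.
  rewrite -[X in _ --> X](mulr0 2); apply: cvgMr.
  by apply/norm_cvg0P; exact: cvg_tilt_scaled.
apply/cvgrPdist_le => e e0; have e2 : 0 < e / 2 by rewrite divr_gt0.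
near=> x.
have x0 : x != 0 by near: x; exact: nbhs_dnbhs_neq.
have x2 : 0 < x ^+ 2 by rewrite exprn_even_gt0.
have xg : `|lambda * sin (x * q)| <= gamma by near: x; exact: near_sin_le_scaled.
have := laplace_estimate (mulr_gt0 x2 z0)
  (rt_eigenvalue_le0 hlambda hkappa hgamma (x * q))
  (measurable_char hlambda hkappa hgamma hY (x * q) c)
  (fun t t0 => char_estimate hlambda hkappa hgamma hY hY0 c xg t0).
have : `|cos c / (z + q ^+ 2 / 2 * sigma2) -
    cos c / (z - rt_eigenvalue (x * q) / x ^+ 2)| <= e / 2.
  by near: x; move/cvgrPdist_le : c1; apply.
have : `|0 - 2 * `|tilt (x * q)| / z | <= e / 2.
  by near: x; move/cvgrPdist_le : c2; apply.
have m0 := rt_eigenvalue_le0 hlambda hkappa hgamma (x * q).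
set a := cos c / _; set I := Rintegral _ _ _; set m := rt_eigenvalue _ in m0 *.
set tl := tilt _ => h1 h2 h3.
have zm : 0 < x ^+ 2 * z - m by rewrite subr_gt0 (le_lt_trans m0)// mulr_gt0.
rewrite -(subrKA (cos c / (z - m / x ^+ 2))) (le_trans (ler_normD _ _))//.
rewrite (splitr e) lerD// distrC.
rewrite [X in `|X| <= _](_ : _ = x ^+ 2 * (I - cos c / (x ^+ 2 * z - m))); last first.
  by field; rewrite x0 gt_eqF.
rewrite normrM (gtr0_norm x2).
apply: (@le_trans _ _ (x ^+ 2 * (2 * `|tl| / (x ^+ 2 * z)))).
  by rewrite ler_wpM2l// ltW.
rewrite [leLHS](_ : _ = 2 * `|tl| / z); last by field; rewrite x0 gt_eqF.
by rewrite (le_trans _ h1)// sub0r normrN ler_norm.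
Unshelve. all: by end_near. Qed.

End diffusive_limit.

Theorem mainTheorem4 (R : realType) (lambda kappa gamma : R)
    (hlambda : 0 <= lambda) (hkappa : 0 <= kappa) (hgamma : 0 < gamma)
    (d : measure_display) (T : measurableType d) (P : probability T R)
    (Y : R -> {RV P >-> state})
    (hY : run_and_tumble lambda kappa gamma Y)
    (hY0 : {ae P, forall w, position (Y 0 w) = 0}) :
  let sigma2 := diffusivity lambda kappa gamma in
  (forall q z : R, 0 < z ->
     ((eps ^+ 2)%:C%C * laplace_char Y (eps * q) (eps ^+ 2 * z) : R[i]^o)
       @[eps --> 0^'] --> (((z + q ^+ 2 / 2 * sigma2)^-1)%:C%C : R[i]^o))
  /\ (forall t : R, 0 < t ->
        cvg_in_distribution P (0 : R)^'+
          (fun eps w => eps * (position (Y (eps ^- 2 * t) w))%:~R)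
          (normal_law 0 (sigma2 * t))).
Proof.
move=> sigma2; split; last first.
  exact: (cvg_position_in_distribution hlambda hkappa hgamma hY hY0).
move=> q z z0.
have c0 := cvg_laplace_scaled hlambda hkappa hgamma hY hY0 (q := q) (c := 0) z0.
have c1 := cvg_laplace_scaled hlambda hkappa hgamma hY hY0 (q := q)
  (c := - (pi / 2)) z0.
rewrite cos0 mul1r in c0; rewrite cosN cos_pihalf mul0r in c1.
under eq_fun do rewrite scaled_laplace_charE.
exact: (cvg_complex c0 c1).
Qed.
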